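(* For (Lebesgue-)almost every choice of the parameters $(C_\parallel,C_\perp,C_\tau,L)\in(0,+\infty)^4$, the $2$-link swimmer is fiber controllable: for any initial $(g_0,s_0)\in SE(3)\times(\mathbb{R}\times\mathbb{T})$ and any final $g_1\in SE(3)$ there exist a time $T>0$ and control inputs $u=(u_1,u_2)\colon[0,T]\to\mathbb{R}^2$ such that the unique solution $(g(t),s(t))$ of the $2$-link control system with $(g(0),s(0))=(g_0,s_0)$ satisfies $g(T)=g_1$.
   Context: The $2$-link swimmer. Given constants $C_\parallel,C_\perp,C_\tau,L>0$ (parallel, perpendicular and torsional drag coefficients, and the common length of the two links), let $\mathbb{T}=\mathbb{R}/2\pi\mathbb{Z}$. The shape is $s=(\vartheta,\varphi)\in\mathbb{R}\times\mathbb{T}$. Put $\tilde e^{(1)}=(0,0,1)^\top$ and $\tilde e^{(2)}=(\sin\varphi\cos\vartheta,\sin\varphi\sin\vartheta,\cos\varphi)^\top$, and let $\tilde E^{(i)}$ be the $3\times3$ matrix with $\tilde E^{(i)}v=\tilde e^{(i)}\times v$. With $(a\otimes b)_{ij}=a_ib_j$, define $$\tilde K=L\sum_{i=1}^2\big[(C_\parallel-C_\perp)\tilde e^{(i)}\otimes\tilde e^{(i)}+C_\perp I\big],\qquad \tilde C=\tfrac{L^2}{2}C_\perp\big(\tilde E^{(1)}+\tilde E^{(2)}\big),$$ $$\tilde J=\tfrac{L^3}{3}C_\perp\sum_{i=1}^2\big[I-\tilde e^{(i)}\otimes\tilde e^{(i)}\big]+LC_\tau\,\tilde e^{(1)}\otimes\tilde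 e^{(1)},\qquad \tilde{\mathcal M}=\begin{pmatrix}\tilde K&\tilde C^\top\\ \tilde C&\tilde J\end{pmatrix}.$$ The $6\times6$ matrix $\tilde{\mathcal M}=\tilde{\mathcal M}(\vartheta,\varphi)$ is symmetric and positive definite. Define $v_1,v_2\colon\mathbb{R}\times\mathbb{T}\to\mathbb{R}^6$ by $$v_1=\tilde{\mathcal M}^{-1}\Big(-\tfrac{L^2}{2}C_\perp\cos\vartheta\cos\varphi,\,-\tfrac{L^2}{2}C_\perp\sin\vartheta\cos\varphi,\,\tfrac{L^2}{2}C_\perp\sin\varphi,\,\tfrac{L^3}{3}C_\perp\sin\vartheta,\,-\tfrac{L^3}{3}C_\perp\cos\vartheta,\,0\Big)^\top,$$ $$v_2=\tilde{\mathcal M}^{-1}\Big(\tfrac{L^2}{2}C_\perp\sin\vartheta\sin\varphi,\,-\tfrac{L^2}{2}C_\perp\cos\vartheta\sin\varphi,\,0,\,\tfrac{L^3}{6}C_\perp\cos\vartheta\sin2\varphi,\,\tfrac{L^3}{6}C_\perp\sin\vartheta\sin2\varphi,\,-\tfrac{L^3}{3}C_\perp\sin^2\varphi\Big)^\top.$$ An element $g\in SE(3)$ is written $g=\begin{pmatrix}R&\mathbf x\\0&1\end{pmatrix}$ with $R\in SO(3)$ (orientation) and $\mathbf x\in\mathbb{R}^3$ (hinge position). Let $\mathcal L\colon\mathbb{R}^6\to\mathfrak{se}(3)$ be $$\mathcal L(y)=\begin{pmatrix}0&-y_6&y_5&y_1\\ y_6&0&-y_4&y_2\\ -y_5&y_4&0&y_3\\0&0&0&0\end{pmatrix}.$$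 The $2$-link control system is $$g^{-1}\dot g=\mathcal L\big(v_1(s)u_1+v_2(s)u_2\big),\qquad \dot\varphi=u_1,\quad\dot\vartheta=u_2\qquad\text{for a.e. }t,$$ where $u_1,u_2\in L^\infty(0,T)$ are the controls; solutions are absolutely continuous. *)

(* Defs.v *)
From HB Require Import structures.
From mathcomp Require Import all_boot all_order all_algebra.
From mathcomp Require Import generic_quotient.
From mathcomp Require Import all_classical all_reals all_analysis.

Set Implicit Arguments.
Unset Strict Implicit.
Unset Printing Implicit Defensive.

Import Order.TTheory GRing.Theory Num.Theory.
Import numFieldNormedType.Exports.

Local Open Scope classical_set_scope.
Local Open Scope ring_scope.
Local Open Scope quotient_scope.

Section Circle.
Variable R : realType.

Definition eqmod2pi (x y : R) : bool :=
  `[< exists k : int, x - y = k%:~R * (2 * pi) >].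

Lemma eqmod2pi_refl : reflexive eqmod2pi.
Proof. by move=> x; apply/asboolP; exists 0; rewrite subrr mul0r. Qed.

Lemma eqmod2pi_sym : symmetric eqmod2pi.
Proof.
suff H x y : eqmod2pi x y -> eqmod2pi y x.
  by move=> x y; apply/idP/idP; exact: H.
move=> /asboolP[k Hk]; apply/asboolP; exists (- k).
by rewrite -opprB Hk mulrNz mulNr.
Qed.

Lemma eqmod2pi_trans : transitive eqmod2pi.
Proof.
move=> y x z /asboolP[k Hk] /asboolP[l Hl]; apply/asboolP; exists (k + l).
by rewrite mulrzDr mulrDl -Hk -Hl addrA subrK.
Qed.

Lemma sinD2piz (x : R) (k : int) : sin (x + k%:~R * (2 * pi)) = sin x.
Proof.
have E n y : sin (y + n%:R * (2 * pi)) = sin y :> R.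
  by rewrite mulr_natl [2 * pi]mulr_natl (periodicn (@sinD2pi R)).
by case: k => n; [exact: E|rewrite NegzE mulrNz mulNr -(E n.+1) subrK].
Qed.

Lemma cosD2piz (x : R) (k : int) : cos (x + k%:~R * (2 * pi)) = cos x.
Proof.
have E n y : cos (y + n%:R * (2 * pi)) = cos y :> R.
  by rewrite mulr_natl [2 * pi]mulr_natl (periodicn (@cosD2pi R)).
by case: k => n; [exact: E|rewrite NegzE mulrNz mulNr -(E n.+1) subrK].
Qed.

Canonical eqmod2pi_equiv :=
  EquivRel eqmod2pi eqmod2pi_refl eqmod2pi_sym eqmod2pi_trans.

Definition circle := {eq_quot eqmod2pi}.

Lemma repr_circleE (x : R) :
  exists k : int, repr (\pi_circle x) = x + k%:~R * (2 * pi).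
Proof.
have /eqmodP/asboolP[k Hk] : repr (\pi_circle x) = x %[mod circle].
  by rewrite reprK.
by exists k; rewrite -Hk addrC subrK.
Qed.

End Circle.

Section Curves.
Variable R : realType.

Definition abs_cont (V : normedModType R) (a b : R) (f : R -> V) : Prop :=
  forall e : R, 0 < e -> exists2 d : R, 0 < d &
    forall (n : nat) (x y : 'I_n -> R),
      (forall i, a <= x i /\ x i <= y i /\ y i <= b) ->
      trivIset [set: 'I_n] (fun i => `]x i, y i[%classic) ->
      \sum_i (y i - x i) < d ->
      \sum_i `|f (y i) - f (x i)| < e.

Definition in_Linfty (T : R) (u : R -> R) : Prop :=
  u \_ `]0, T[ \in Lfun (@lebesgue_measure R) +oo%E.

(* An absolutely continuous curve in the circle is one which has an absolutely
   continuous lift to R; its velocity is that of the lift. *)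
Definition circle_curve_velocity (T : R) (c : R -> circle R) (u : R -> R) :=
  exists l : R -> R,
    [/\ abs_cont 0 T l,
        forall t, t \in `[0, T] -> c t = \pi_(circle R) (l t) &
        {ae lebesgue_measure, forall t : R, t \in `]0, T[ ->
           is_derive t 1 l (u t)}].

End Curves.

Section Matrices.
Variable R : comNzRingType.

Definition colseq n (s : seq R) : 'cV[R]_n := \col_(i < n) nth 0 s i.

Definition mxseq m n (s : seq (seq R)) : 'M[R]_(m, n) :=
  \matrix_(i < m, j < n) nth 0 (nth [::] s i) j.

Definition cross (a b : 'cV[R]_3) : 'cV[R]_3 :=
  colseq 3 [:: a 1 0 * b 2 0 - a 2 0 * b 1 0;
               a 2 0 * b 0 0 - a 0 0 * b 2 0;
               a 0 0 * b 1 0 - a 1 0 * b 0 0].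

Definition crossmx (e : 'cV[R]_3) : 'M[R]_3 :=
  mxseq 3 3 [:: [:: 0;         - e 2 0;  e 1 0];
                [:: e 2 0;     0;        - e 0 0];
                [:: - e 1 0;   e 0 0;    0]].

Lemma crossmxE (e v : 'cV[R]_3) : crossmx e *m v = cross e v.
Proof.
have ->: v = colseq 3 [:: v 0 0; v 1 0; v 2 0].
  apply/colP => -[[|[|[|//]]] ?]; rewrite mxE /=; congr (v _ _); exact: val_inj.
apply/colP => -[[|[|[|//]]] ?]; rewrite !mxE !big_ord_recr big_ord0 /= !mxE /=;
  by rewrite ?mul0r ?add0r ?addr0 mulNr // addrC.
Qed.

Definition in_SO3 (Q : 'M[R]_3) : Prop := Q^T *m Q = 1%:M /\ \det Q = 1.

Definition in_SE3 (g : 'M[R]_4) : Prop :=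
  exists (Q : 'M[R]_3) (x : 'cV[R]_3),
    in_SO3 Q /\ g = block_mx Q x (0 : 'rV[R]_3) (1%:M : 'M[R]_1).

Definition se3_of (y : 'cV[R]_6) : 'M[R]_4 :=
  mxseq 4 4 [:: [:: 0;         - y 5 0;  y 4 0;    y 0 0];
                [:: y 5 0;     0;        - y 3 0;  y 1 0];
                [:: - y 4 0;   y 3 0;    0;        y 2 0];
                [:: 0;         0;        0;        0]].

End Matrices.

Section Swimmer.
Variable R : realType.
Variables Cpar Cperp Ctau L : R.

(* The shape is (th, ph), with ph an arbitrary real representative. *)
Section Coordinates.
Variables th ph : R.

Definition tensor (a b : 'cV[R]_3) : 'M[R]_3 := \matrix_(i, j) (a i 0 * b j 0).

Definition axis1 : 'cV[R]_3 := colseq 3 [:: 0; 0; 1].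

Definition axis2 : 'cV[R]_3 :=
  colseq 3 [:: sin ph * cos th; sin ph * sin th; cos ph].

Definition resK : 'M[R]_3 :=
  L *: (((Cpar - Cperp) *: tensor axis1 axis1 + Cperp *: 1%:M)
        + ((Cpar - Cperp) *: tensor axis2 axis2 + Cperp *: 1%:M)).

Definition resC : 'M[R]_3 :=
  (L ^+ 2 / 2 * Cperp) *: (crossmx axis1 + crossmx axis2).

Definition resJ : 'M[R]_3 :=
  (L ^+ 3 / 3 * Cperp) *: ((1%:M - tensor axis1 axis1)
                           + (1%:M - tensor axis2 axis2))
  + (L * Ctau) *: tensor axis1 axis1.

Definition resM : 'M[R]_6 := block_mx resK resC^T resC resJ.

Definition v1_coord : 'cV[R]_6 :=
  invmx resM *m colseq 6
    [:: - (L ^+ 2 / 2) * Cperp * cos th * cos ph;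
        - (L ^+ 2 / 2) * Cperp * sin th * cos ph;
        L ^+ 2 / 2 * Cperp * sin ph;
        L ^+ 3 / 3 * Cperp * sin th;
        - (L ^+ 3 / 3) * Cperp * cos th;
        0].

Definition v2_coord : 'cV[R]_6 :=
  invmx resM *m colseq 6
    [:: L ^+ 2 / 2 * Cperp * sin th * sin ph;
        - (L ^+ 2 / 2) * Cperp * cos th * sin ph;
        0;
        L ^+ 3 / 6 * Cperp * cos th * sin (2 * ph);
        L ^+ 3 / 6 * Cperp * sin th * sin (2 * ph);
        - (L ^+ 3 / 3) * Cperp * sin ph ^+ 2].

End Coordinates.

Definition shape : Type := (R * circle R)%type.

Definition v1 (s : shape) : 'cV[R]_6 := v1_coord s.1 (repr s.2).
Definition v2 (s : shape) : 'cV[R]_6 := v2_coord s.1 (repr s.2).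

(* The choice of representative is immaterial. *)
Lemma v1E (th x : R) : v1 (th, \pi_(circle R) x) = v1_coord th x.
Proof.
rewrite /v1 /=; have [k ->] := repr_circleE x.
by rewrite /v1_coord /resM /resK /resC /resJ /axis2 sinD2piz cosD2piz.
Qed.

Lemma v2E (th x : R) : v2 (th, \pi_(circle R) x) = v2_coord th x.
Proof.
rewrite /v2 /=; have [k ->] := repr_circleE x.
have E : sin (2 * (x + k%:~R * (2 * pi))) = sin (2 * x).
  by rewrite mulrDr mulrA -[2 * k%:~R]/(2%:~R * k%:~R) -intrM sinD2piz.
by rewrite /v2_coord /resM /resK /resC /resJ /axis2 E sinD2piz cosD2piz.
Qed.

Definition is_solution (T : R) (u1 u2 : R -> R)
    (g : R -> 'M[R]_4) (s : R -> shape) : Prop :=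
  [/\ abs_cont 0 T g /\ (forall t, t \in `[0, T] -> in_SE3 (g t)),
      {ae lebesgue_measure, forall t : R, t \in `]0, T[ ->
         derivable g t 1 /\
         invmx (g t) *m derive1 g t =
           se3_of (u1 t *: v1 (s t) + u2 t *: v2 (s t))},
      circle_curve_velocity T (fun t => (s t).2) u1,
      abs_cont 0 T (fun t => (s t).1 : R^o) &
      {ae lebesgue_measure, forall t : R, t \in `]0, T[ ->
         is_derive t 1 (fun r => (s r).1 : R^o) (u2 t)}].

(* Controls are Borel representatives of their L^oo(0, T) classes, extended
   arbitrarily outside ]0, T[; solutions are likewise only relevant on [0, T]. *)
Definition fiber_controllable : Prop :=
  forall (g0 : 'M[R]_4) (s0 : shape) (g1 : 'M[R]_4),
    in_SE3 g0 -> in_SE3 g1 ->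
    exists (T : R) (u1 u2 : R -> R),
      [/\ 0 < T, in_Linfty T u1, in_Linfty T u2 &
          exists (g : R -> 'M[R]_4) (s : R -> shape),
            [/\ is_solution T u1 u2 g s, g 0 = g0, s 0 = s0, g T = g1 &
                forall (g' : R -> 'M[R]_4) (s' : R -> shape),
                  is_solution T u1 u2 g' s' -> g' 0 = g0 -> s' 0 = s0 ->
                  forall t, t \in `[0, T] -> g' t = g t /\ s' t = s t]].

End Swimmer.

Definition lebesgue_measure4 (R : realType) :=
  (@lebesgue_measure R \x @lebesgue_measure R
     \x @lebesgue_measure R \x @lebesgue_measure R)%E.
Arguments lebesgue_measure4 : clear implicits.

(* Main.v *)
(** The frame [h = g Rz(th)] is attached to the plane of the two links, and in it
    the velocity does not depend on [th].  Bending (changing [ph] alone) moves the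
    hinge along the bisector of the links, whose direction stays fixed; hence
    [k = h P(ph)^-1] is unchanged, where [P(ph)] places the first link relative to
    the bisector.  Spinning (changing [th] alone) moves the rigid V-shaped body as
    if a torque were applied along the first link, so it multiplies [k] on the right
    by a rotation about a line that crosses the bisector at height
    [m(ph) = d(ph) + (L/2) cos(ph/2)], where [d] is the displacement of the hinge.
    The line is the bisector itself for [ph = 0], is perpendicular to it for
    [ph = pi] and is oblique for [ph = pi/2], and
    [m' = (L/4) sin(ph/2) cos(ph/2)^2 (Cperp - Cpar) / (Cpar cos(ph/2)^2 + Cperp sin(ph/2)^2)],
    so that [m(pi) <> m(pi/2)] unless [Cpar = Cperp].  The first two families of
    rotations generate the rotations about a point, and adding the third one gives
    SE(3).  Conjugating a rotation about the bisector by a half-turn at [ph = pi]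
    inverts it, and this commutator trick lets [th] be changed at will.  A solution
    is unique because for any other one, [g'], the curve [g' g^-1] is absolutely
    continuous with zero derivative almost everywhere. *)

Require Import Defs.
From mathcomp Require Import all_boot all_order all_algebra.
From mathcomp Require Import all_classical all_reals all_analysis.
From mathcomp Require Import measurable_realfun ess_sup_inf ring lra.

Set Implicit Arguments.
Unset Strict Implicit.
Unset Printing Implicit Defensive.

Import Order.TTheory GRing.Theory Num.Theory.
Import numFieldNormedType.Exports.

Local Open Scope classical_set_scope.
Local Open Scope ring_scope.

(** * Absolutely continuous functions *)

Section AbsCont.
Variable R : realType.
Implicit Types f g : R -> R.

(** Compactness of the segment in the form of Cousin's lemma: at the supremum [c] of the points [x]
    with [Q a x], the local hypothesis carries [Q a] past [c], unless [c = b]. *)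
Lemma cousin (Q : R -> R -> Prop) (a b : R) : a <= b ->
  (forall x y z, Q x y -> Q y z -> Q x z) ->
  (forall x, a <= x <= b -> exists2 r, 0 < r &
     forall s t, a <= s -> s <= x -> x <= t -> t <= b ->
       x - r < s -> t < x + r -> Q s t) ->
  Q a b.
Proof.
move=> ab Qtr Qloc.
pose S := [set x | a <= x <= b /\ Q a x].
have Sa : S a.
  split; first by rewrite lexx.
  by have [|r r0 ] := Qloc a; rewrite ?lexx //; apply; rewrite ?ltrBlDr ?ltrDl.
have hsS : has_sup S by split; [exists a | exists b => x [/andP[]]].
pose c := sup S.
have ac : a <= c by apply: sup_upper_bound.
have cb : c <= b by apply: ge_sup; [exists a | move=> x [/andP[]]].
have [|r r0 Qr] := Qloc c; first by rewrite ac.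
have [s Ss cs] := sup_adherent r0 hsS.
have sc : s <= c by apply: sup_upper_bound.
have [/andP[as_ sb] Qas] := Ss.
pose t := Num.min b (c + r / 2).
have ct : c <= t by rewrite le_min cb lerDl divr_ge0 // ltW.
have tb : t <= b by rewrite ge_min lexx.
have tcr : t < c + r by rewrite gt_min; apply/orP; right; lra.
have Qat : Q a t by apply: Qtr Qas _; apply: Qr.
have St : S t by split => //; rewrite (le_trans ac ct).
have tc : t <= c by apply: sup_upper_bound.
suff <- : t = b by [].
move: tc; rewrite /t; case: (leP b (c + r / 2)) => //; lra.
Qed.

Lemma abs_cont_pt (V : normedModType R) (a b : R) (f : R -> V) (e : R) :
  abs_cont a b f -> 0 < e ->
  exists2 d, 0 < d & forall x y, a <= x -> x <= y -> y <= b -> y - x < d ->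
    `|f y - f x| < e.
Proof.
move=> acf e0; have [d d0 H] := acf e e0; exists d => // x y ax xy yb yx.
have := H 1%N (fun=> x) (fun=> y); rewrite !big_ord1; apply => //.
by move=> i j _ _ _; rewrite !ord1.
Qed.

Lemma abs_cont_bounded (a b : R) f : abs_cont a b f ->
  exists M, forall t, a <= t <= b -> `|f t| <= M.
Proof.
move=> acf; have [ab|ba] := leP a b; last first.
  by exists 0 => t /andP[at_ tb]; lra.
apply: (@cousin
  (fun x y => exists M, forall t, x <= t <= y -> `|f t| <= M)) => //.
- move=> x y z [M HM] [N HN]; exists (Num.max M N) => t /andP[xt tz].
  rewrite le_max; have [ty|yt] := leP t y.
    by rewrite HM // xt.
  by rewrite HN ?orbT // tz ltW.
- move=> x /andP[ax xb]; have [d d0 H] := abs_cont_pt acf ltr01.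
  exists d => // s t as_ sx xt tb xs tx; exists (`|f x| + 1) => u /andP[su ut].
  suff : `|f u - f x| < 1.
    by move=> H1; have := ler_normD (f u - f x) (f x); rewrite subrK; lra.
  have [ux|xu] := leP u x.
    by rewrite distrC; apply: H => //; lra.
  by apply: H; lra.
Qed.

Let chain_sum f (s : seq (R * R)) := \sum_(p <- s) `|f p.2 - f p.1|.

(** Ordered intervals are disjoint, so their total length is at most the measure of [U], which is
    below the threshold [d] of absolute continuity. *)
Lemma chain_sum_lt (U : set R) (a b d e : R) f (s : seq (R * R)) :
  open U -> (@lebesgue_measure R U < d%:E)%E ->
  (forall (n : nat) (x y : 'I_n -> R),
      (forall i, a <= x i /\ x i <= y i /\ y i <= b) ->
      trivIset [set: 'I_n] (fun i => `]x i, y i[%classic) ->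
      \sum_i (y i - x i) < d ->
      \sum_i `|f (y i) - f (x i)| < e) ->
  (forall p, p \in s -> [/\ a <= p.1, p.1 <= p.2, p.2 <= b & `]p.1, p.2[ `<=` U]) ->
  pairwise (fun p q : R * R => p.2 <= q.1) s ->
  chain_sum f s < e.
Proof.
move=> oU Ud acf sP sdis.
rewrite /chain_sum (big_nth (0, 0)) big_mkord.
pose x (i : 'I_(size s)) := (nth (0, 0) s i).1.
pose y (i : 'I_(size s)) := (nth (0, 0) s i).2.
have mem i : (nth (0, 0) s (i : 'I_(size s))) \in s by rewrite mem_nth.
have tx : trivIset [set: 'I_(size s)] (fun i => `]x i, y i[%classic).
  have main (i j : 'I_(size s)) : (i < j)%N -> `]x i, y i[ `&` `]x j, y j[ !=set0 -> False.
    move=> ij [t [/=]]; rewrite !in_itv /= => /andP[_ ty] /andP[xt _].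
    have /(pairwiseP (0, 0)) /(_ i j) := sdis.
    rewrite !inE => /(_ (ltn_ord i) (ltn_ord j) ij); rewrite -/(y i) -/(x j); lra.
  move=> i j _ _ ne; apply/val_inj; case: (ltngtP (val i) (val j)) => // ij.
    by case: (main i j).
  by case: (main j i) => //; rewrite setIC.
apply: (acf _ x y) => //.
  by move=> i; have [? ? ? _] := sP _ (mem i).
rewrite -lte_fin; apply: le_lt_trans Ud.
rewrite -sumEFin (eq_bigr (fun i => @lebesgue_measure R `]x i, y i[%classic)); last first.
  move=> i _; rewrite lebesgue_measure_itv /= lte_fin.
  case: ltP => // yx; have [_ xy _ _] := sP _ (mem i).
  by have -> : y i = x i; [apply/le_anti; rewrite yx | rewrite subrr].
rewrite -measure_semi_additive_ord //; last first.
  by apply: bigsetU_measurable.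
apply: le_measure; rewrite ?inE.
- by apply: bigsetU_measurable.
- exact: open_measurable.
- elim/big_ind: _ => [|A B AU BU|i _]; first exact: sub0set.
    by rewrite subUset.
  by have [] := sP _ (mem i).
Qed.

Local Notation mu := (@lebesgue_measure R).

Lemma is_derive0_near f (x e : R) : is_derive x 1 f 0 -> 0 < e ->
  exists2 r, 0 < r & forall t, `|t - x| < r -> `|f t - f x| <= e * `|t - x|.
Proof.
move=> [fx f0] e0; move: fx; rewrite /derivable => /cvg_ex[l fl].
have l0 : l = 0 by move/cvg_lim : (fl) => /(_ (@norm_hausdorff _ _)) <-; exact: f0.
rewrite l0 in fl.
have /cvgrPdist_le /(_ _ e0) [r /= r0 H] := fl.
exists r => // t tx; have [->|tnx] := eqVneq t x.
  by rewrite !subrr normr0 mulr0.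
have := H (t - x); rewrite /ball_ /= sub0r normrN => /(_ tx).
rewrite subr_eq0 => /(_ tnx).
rewrite sub0r normrN /GRing.scale /= mulr1 subrK normrM normfV.
by rewrite mulrC ler_pdivrMr // normr_gt0 subr_eq0.
Qed.

Lemma ae_finite (E : seq R) : {ae mu, forall x, x \notin E}.
Proof.
have cE : countable [set` E] by exact/finite_set_countable/finite_seq.
exists [set` E]; split.
- exact: countable_measurable.
- exact: countable_lebesgue_measure0.
- by move=> x /= /negP; rewrite negbK.
Qed.

(* Cover the exceptional null set by an open set of small measure; Cousin's lemma
   then splits the segment into intervals where [f] is almost flat and intervals
   lying in that open set, on which absolute continuity controls [f]. *)
Lemma abs_cont_derive0 (a b : R) f : abs_cont a b f ->
  {ae mu, forall t, t \in `]a, b[ -> is_derive t 1 f 0} ->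
  forall t, t \in `[a, b] -> f t = f a.
Proof.
move=> acf df t tab; apply/eqP; rewrite -subr_eq0 -normr_le0.
have [at_ tb] : a <= t /\ t <= b by move: tab; rewrite in_itv => /andP.
apply/ler_addgt0Pl => e' e'0; rewrite addr0.
(* The budget [e'] is split into a slope [e] over the length [t - a] and a further [e] for the
   intervals inside the small open set. *)
pose e := e' / (t - a + 1).
have e0 : 0 < e by rewrite divr_gt0 //; lra.
have -> : e' = e * (t - a) + e by rewrite /e -[X in _ + X]mulr1 -mulrDr mulfVK //; lra.
have [d d0 acfd] := acf e e0.
(* Cousin's lemma needs a local statement at the endpoints too; they form a null set and join the
   exceptional points. *)
have : {ae mu, forall t, t \in `[a, b] -> is_derive t 1 f 0}.
  have FF : Filter (almost_everywhere mu) by exact: ae_filter_ringOfSetsType.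
  move: df (ae_finite [:: a; b]); apply: filterS2 => x dfx xI xab; apply: dfx.
  have [xa xb] : x != a /\ x != b by apply/andP; move: xI; rewrite !inE negb_or.
  have [ax xb'] : a <= x /\ x <= b by apply/andP; move: xab; rewrite in_itv.
  by rewrite in_itv /= !lt_neqAle ax xb' xb eq_sym xa.
case=> N [mN N0 dN].
have /negligible_outer_measure N0' : mu.-negligible N by exists N; split.
have d20 : 0 < d / 2 by rewrite divr_gt0.
have [U [oU NU]] := outer_measure_open_le N d20.
rewrite N0' add0e => muU.
have {}muU : (mu U < d%:E)%E by apply: le_lt_trans muU _; rewrite lte_fin; lra.
(* The list of intervals is kept instead of a bound on its increments: lists concatenate, whereas
   absolute continuity gives smallness only for the whole chain at once. *)
pose Q x y := exists s : seq (R * R), [/\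
  x <= y,
  forall p, p \in s -> [/\ x <= p.1, p.1 <= p.2, p.2 <= y & `]p.1, p.2[ `<=` U],
  pairwise (fun p q : R * R => p.2 <= q.1) s &
  `|f y - f x| <= e * (y - x) + \sum_(p <- s) `|f p.2 - f p.1|].
suff [s [_ sP sdis fs]] : Q a t.
  apply: le_trans fs _; rewrite lerD2l; apply/ltW.
  apply: (chain_sum_lt oU muU acfd _ sdis) => p /sP[ap pp pt pU]; split => //.
  exact: le_trans tb.
apply: cousin => //.
- move=> x y z [s [xy sP sd fs]] [s' [yz sP' sd' fs']]; exists (s ++ s'); split.
  + exact: le_trans yz.
  + move=> p; rewrite mem_cat => /orP[/sP|/sP'] [h1 h2 h3 h4]; split => //.
      exact: le_trans yz.
    exact: le_trans h1.
  + rewrite pairwise_cat sd sd' !andbT; apply/allrelP => p q /sP[_ _ py _] /sP'[yq _ _ _].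
    exact: le_trans yq.
  + rewrite big_cat /=; have := ler_normD (f z - f y) (f y - f x).
    rewrite subrKA; lra.
- move=> x /andP[ax xt].
  have xab : x \in `[a, b] by rewrite in_itv /= ax (le_trans xt tb).
  have [dfx|ndfx] := pselect (is_derive x 1 f 0).
    have [r r0 H] := is_derive0_near dfx e0.
    exists r => // u v au ux xv vt xu vx; exists [::]; split => //; first lra.
    rewrite big_nil addr0.
    have h1 : `|u - x| = x - u by rewrite distrC ger0_norm // subr_ge0.
    have h2 : `|v - x| = v - x by rewrite ger0_norm // subr_ge0.
    have hu := H u; have hv := H v.
    have {}hu := hu ltac:(lra); have {}hv := hv ltac:(lra).
    rewrite h1 in hu; rewrite h2 in hv.
    have := ler_normB (f v - f x) (f u - f x); rewrite opprB addrA subrK.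
    nra.
  have Ux : U x by apply: NU; apply: dN => /= /(_ xab).
  have /nbhs_ballP[r /= r0 xrU] : nbhs x U by apply: open_nbhs_nbhs.
  exists r => // u v au ux xv vt xu vx; exists [:: (u, v)]; split => //.
  + exact: le_trans xv.
  + move=> p; rewrite inE => /eqP -> /=; split => //; first exact: le_trans xv.
    move=> w; rewrite /= in_itv /= => /andP[uw wv]; apply: xrU.
    by rewrite /ball /= ltr_norml; apply/andP; split; lra.
  + by rewrite big_seq1 /= lerDr; apply: mulr_ge0; [exact: ltW | lra].
Qed.

Lemma abs_contD (a b : R) f g : abs_cont a b f -> abs_cont a b g ->
  abs_cont a b (fun t => f t + g t).
Proof.
move=> acf acg e e0; have e20 : 0 < e / 2 by rewrite divr_gt0.
have [d d0 fd] := acf _ e20; have [d' d'0 gd] := acg _ e20.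
exists (Num.min d d'); first by rewrite lt_min d0.
move=> n x y xy dis; rewrite lt_min => /andP[xyd xyd'].
have := fd n x y xy dis xyd; have := gd n x y xy dis xyd'.
suff : \sum_i `|f (y i) + g (y i) - (f (x i) + g (x i))| <=
  \sum_i `|f (y i) - f (x i)| + \sum_i `|g (y i) - g (x i)| by lra.
rewrite -big_split /=; apply: ler_sum => i _.
by rewrite opprD addrACA ler_normD.
Qed.

Lemma abs_contM (a b : R) f g : abs_cont a b f -> abs_cont a b g ->
  abs_cont a b (fun t => f t * g t).
Proof.
move=> acf acg e e0.
have [M HM] := abs_cont_bounded acf; have [N HN] := abs_cont_bounded acg.
(* The 1 keeps [K] positive, as the division by [K] requires. *)
pose K := Num.max 1 (Num.max M N).
have K1 : 1 <= K by rewrite le_max lexx.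
have fK t : a <= t <= b -> `|f t| <= K by move/HM => h; rewrite !le_max h orbT.
have gK t : a <= t <= b -> `|g t| <= K by move/HN => h; rewrite !le_max h !orbT.
have e20 : 0 < e / (2 * K) by rewrite divr_gt0 // mulr_gt0 //; lra.
have [d d0 fd] := acf _ e20; have [d' d'0 gd] := acg _ e20.
exists (Num.min d d'); first by rewrite lt_min d0.
move=> n x y xy dis; rewrite lt_min => /andP[xyd xyd'].
have := fd n x y xy dis xyd; have := gd n x y xy dis xyd'.
set F := \sum_i `|f _ - _|; set G := \sum_i `|g _ - _|.
have -> : e / (2 * K) = e / 2 / K by rewrite invfM mulrA.
rewrite !ltr_pdivlMr; try lra.
suff : \sum_i `|f (y i) * g (y i) - f (x i) * g (x i)| <= F * K + G * K by lra.
rewrite /F /G -mulrDl -big_split /= mulr_suml; apply: ler_sum => i _.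
have [ax [xyi yb]] := xy i.
have -> : f (y i) * g (y i) - f (x i) * g (x i) =
  (f (y i) - f (x i)) * g (y i) + (g (y i) - g (x i)) * f (x i) by ring.
rewrite [leRHS]mulrDl; apply: le_trans (ler_normD _ _) _; rewrite !normrM.
apply: lerD; apply: ler_wpM2l => //.
  by apply: gK; rewrite yb (le_trans ax).
by apply: fK; rewrite ax (le_trans xyi).
Qed.

Lemma abs_cont_sum (I : Type) (r : seq I) (a b : R) (f : I -> R -> R) :
  (forall i, abs_cont a b (f i)) -> abs_cont a b (fun t => \sum_(i <- r) f i t).
Proof.
move=> acf; elim: r => [|i r IH].
  move=> e e0; exists 1 => // n x y _ _ _.
  by rewrite big1 // => j _; rewrite !big_nil subrr normr0.
have := abs_contD (acf i) IH; congr (abs_cont a b).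
by apply/funext => t; rewrite big_cons.
Qed.

End AbsCont.

(** * Lipschitz curves *)

Section Lipschitz.
Variable R : realType.

(** The curves constructed below have bounded velocity; this property is easier to carry through
    products and concatenations than absolute continuity, which it implies. *)
Definition lip_on (a b : R) (f : R -> R) := exists2 K : R, 0 <= K &
  forall s t, a <= s <= b -> a <= t <= b -> `|f s - f t| <= K * `|s - t|.

Definition mlip_on m n (a b : R) (F : R -> 'M[R]_(m, n)) :=
  forall i j, lip_on a b (fun t => F t i j).

Lemma lip_on_bounded a b f : lip_on a b f ->
  exists2 M, 0 <= M & forall t, a <= t <= b -> `|f t| <= M.
Proof.
case=> K K0 fK; exists (`|f a| + K * `|b - a|); first by rewrite addr_ge0 ?mulr_ge0.
move=> t /andP[at_ tb]; rewrite -[f t](subrK (f a)) addrC.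
apply: le_trans (ler_normD _ _) _; rewrite lerD2l.
apply: le_trans (fK _ _ _ _) _; rewrite ?at_ ?lexx ?(le_trans at_ tb) //.
by rewrite ler_wpM2l // !ger0_norm ?subr_ge0 ?lerD2r // (le_trans at_ tb).
Qed.

Lemma lip_on_cst a b (c : R) : lip_on a b (fun=> c).
Proof. by exists 0 => // s t _ _; rewrite subrr normr0 mul0r. Qed.

Lemma lip_onD a b f g : lip_on a b f -> lip_on a b g ->
  lip_on a b (fun t => f t + g t).
Proof.
move=> [K K0 fK] [M M0 gM]; exists (K + M); first exact: addr_ge0.
move=> s t sab tab; rewrite opprD addrACA mulrDl.
by apply: le_trans (ler_normD _ _) _; apply: lerD; auto.
Qed.

Lemma lip_onM a b f g : lip_on a b f -> lip_on a b g ->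
  lip_on a b (fun t => f t * g t).
Proof.
move=> lf lg; have [A A0 fA] := lip_on_bounded lf.
have [B B0 gB] := lip_on_bounded lg.
case: lf => K K0 fK; case: lg => M M0 gM.
exists (K * B + M * A); first by rewrite addr_ge0 ?mulr_ge0.
move=> s t sab tab.
have -> : f s * g s - f t * g t = (f s - f t) * g s + (g s - g t) * f t by ring.
apply: le_trans (ler_normD _ _) _; rewrite !normrM mulrDl.
by apply: lerD; rewrite mulrAC ler_pM ?mulr_ge0 ?fK ?gM ?gB ?fA.
Qed.

Lemma lip_on_sum (I : Type) (r : seq I) a b (f : I -> R -> R) :
  (forall i, lip_on a b (f i)) -> lip_on a b (fun t => \sum_(i <- r) f i t).
Proof.
move=> lf; elim: r => [|i r IH].
  by under eq_fun do rewrite big_nil; exact: lip_on_cst.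
by under eq_fun do rewrite big_cons; exact: lip_onD.
Qed.

Lemma mlip_on_cst m n a b (C : 'M[R]_(m, n)) : mlip_on a b (fun=> C).
Proof. by move=> i j; exact: lip_on_cst. Qed.

Lemma mlip_on_mul m n p a b (F : R -> 'M[R]_(m, n)) (G : R -> 'M[R]_(n, p)) :
  mlip_on a b F -> mlip_on a b G -> mlip_on a b (fun t => F t *m G t).
Proof.
move=> lF lG i j; under eq_fun do rewrite mxE.
by apply: lip_on_sum => k; exact: lip_onM.
Qed.

Lemma lip_on_derive (a b : R) (f df : R -> R) (K : R) :
  (forall t : R, is_derive t 1 f (df t)) -> (forall t, `|df t| <= K) ->
  lip_on a b f.
Proof.
move=> fd dfK; exists K; first by apply: le_trans (dfK 0).
suff H s t : s <= t -> `|f s - f t| <= K * `|s - t|.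
  move=> s t _ _; have [|/ltW] := leP s t; first exact: H.
  by move/H; rewrite distrC (distrC s).
move=> st; rewrite distrC (distrC s).
have [|c _ ->] := MVT_segment st (fun x _ => fd x) _; last first.
  by rewrite normrM ler_wpM2r.
apply: derivable_within_continuous => x _.
by have [] := fd x.
Qed.

Lemma abs_cont_lip (V : normedModType R) (a b K : R) (f : R -> V) : 0 <= K ->
  (forall s t, a <= s <= b -> a <= t <= b -> `|f s - f t| <= K * `|s - t|) ->
  abs_cont a b f.
Proof.
move=> K0 fK e e0; exists (e / (K + 1)); first by rewrite divr_gt0 //; lra.
move=> n x y xy _; rewrite ltr_pdivlMr ?mulr_suml; last lra.
apply: le_lt_trans; apply: ler_sum => i _; have [ax [xyi yb]] := xy i.
apply: le_trans (fK _ _ _ _) _; rewrite ?ax ?(le_trans ax) ?(le_trans _ yb) //.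
rewrite ger0_norm ?subr_ge0 // mulrC ler_wpM2l ?subr_ge0 //; lra.
Qed.

Lemma abs_cont_lip_on a b (f : R -> R) : lip_on a b f -> abs_cont a b f.
Proof. by case=> K K0 fK; exact: abs_cont_lip fK. Qed.

Lemma abs_cont_entry m n (a b : R) (F : R -> 'M[R]_(m.+1, n.+1)) i j :
  abs_cont a b F -> abs_cont a b (fun t => F t i j).
Proof.
move=> acF e e0; have [d d0 H] := acF e e0; exists d => // k x y xy dis xyd.
apply: le_lt_trans (H k x y xy dis xyd); apply: ler_sum => l _.
rewrite [leRHS]/Num.Def.normr /= mx_normrE.
by have := le_bigmax 0 (fun ij => `|(F (y l) - F (x l)) ij.1 ij.2|) (i, j); rewrite !mxE.
Qed.

Lemma abs_cont_mlip m n (a b : R) (F : R -> 'M[R]_(m.+1, n.+1)) :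
  mlip_on a b F -> abs_cont a b F.
Proof.
move=> lF; have /choice[K HK] (ij : 'I_m.+1 * 'I_n.+1) : exists K, 0 <= K /\
    forall s t, a <= s <= b -> a <= t <= b ->
    `|F s ij.1 ij.2 - F t ij.1 ij.2| <= K * `|s - t|.
  by have [K K0 H] := lF ij.1 ij.2; exists K.
(* The sum of the constants of all entries is a constant for the maximum norm of matrices. *)
have K0 : 0 <= \sum_ij K ij by apply: sumr_ge0 => ij _; have [] := HK ij.
apply: (abs_cont_lip K0) => s t sab tab.
rewrite [leLHS]/Num.Def.normr /= mx_normrE; apply: bigmax_le; first by rewrite mulr_ge0.
move=> ij _; rewrite !mxE; have [_ H] := HK ij.
apply: le_trans (H s t sab tab) _; rewrite ler_wpM2r // (bigD1 ij) //= lerDl.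
by apply: sumr_ge0 => kl _; have [] := HK kl.
Qed.

End Lipschitz.

(** * Derivatives of matrix-valued curves *)

Section MatrixDerive.
Variable R : realType.

Lemma is_derive_mxP m n (M : R -> 'M[R]_(m.+1, n.+1)) (t : R) dM :
  is_derive t 1 M dM <-> forall i j, is_derive t 1 (fun x => M x i j) (dM i j).
Proof.
split=> [[dv <-] i j|H].
  have := dv; move/derivable_mxP => /(_ i j) dij.
  by apply: DeriveDef => //; rewrite derive_mx // mxE.
have dv : derivable M t 1.
  by apply/derivable_mxP => i j; have [] := H i j.
apply: DeriveDef => //; rewrite derive_mx //.
by apply/matrixP => i j; rewrite mxE; have [_ ->] := H i j.
Qed.

Lemma is_derive_sum_seq (I : Type) (r : seq I) (f : I -> R -> R) (df : I -> R) (t : R) :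
  (forall i, is_derive t 1 (f i) (df i)) ->
  is_derive t 1 (fun x => \sum_(i <- r) f i x) (\sum_(i <- r) df i).
Proof.
move=> H; elim: r => [|i r IH].
  by under eq_fun do rewrite big_nil; rewrite big_nil; exact: is_derive_cst.
by under eq_fun do rewrite big_cons; rewrite big_cons; exact: is_deriveD.
Qed.

Lemma is_derive_mulmx m n p (F : R -> 'M[R]_(m.+1, n.+1))
    (G : R -> 'M[R]_(n.+1, p.+1)) dF dG (t : R) :
  is_derive t 1 F dF -> is_derive t 1 G dG ->
  is_derive t 1 (fun x => F x *m G x) (dF *m G t + F t *m dG).
Proof.
move=> /is_derive_mxP HF /is_derive_mxP HG; apply/is_derive_mxP => i j.
under eq_fun do rewrite mxE.
rewrite !mxE -big_split /=; apply: is_derive_sum_seq => k.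
apply: (@is_derive_eq _ _ _ _ _ _ _ _ (is_deriveM (HF i k) (HG k j))).
by rewrite /GRing.scale /=; ring.
Qed.

Lemma is_derive_mulmxl m n p (C : 'M[R]_(m.+1, n.+1))
    (G : R -> 'M[R]_(n.+1, p.+1)) dG (t : R) :
  is_derive t 1 G dG -> is_derive t 1 (fun x => C *m G x) (C *m dG).
Proof.
move=> HG; have := is_derive_mulmx (is_derive_cst C t 1) HG.
by rewrite mul0mx add0r.
Qed.

Lemma is_derive_mulmxr m n p (F : R -> 'M[R]_(m.+1, n.+1))
    (C : 'M[R]_(n.+1, p.+1)) dF (t : R) :
  is_derive t 1 F dF -> is_derive t 1 (fun x => F x *m C) (dF *m C).
Proof.
move=> HF; have := is_derive_mulmx HF (is_derive_cst C t 1).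
by rewrite mulmx0 addr0.
Qed.

End MatrixDerive.

(** * Concatenation of curves in time, and bounded controls *)

Section Paste.
Variable R : realType.

Definition paste (T : Type) (a : R) (f g : R -> T) (t : R) :=
  if t <= a then f t else g (t - a).

Lemma is_derive_pastel (V : normedModType R) (a t : R) (f g : R -> V) df :
  t < a -> is_derive t 1 f df -> is_derive t 1 (paste a f g) df.
Proof.
move=> ta; apply: near_eq_is_derive; near=> x.
by rewrite /paste ifT // ltW //; near: x; exact: lt_nbhsl.
Unshelve. all: by end_near. Qed.

Lemma is_derive_subr (V : normedModType R) (a t : R) (g : R -> V) dg :
  is_derive (t - a) 1 g dg -> is_derive t 1 (fun x => g (x - a)) dg.
Proof.
have E : (fun h : R => h^-1 *: (g (h *: 1 + t - a) - g (t - a))) =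
         (fun h : R => h^-1 *: (g (h *: 1 + (t - a)) - g (t - a))).
  by apply/funext => h; rewrite addrA.
move=> [dv de]; apply: DeriveDef.
  by move: dv; rewrite /derivable -E.
by rewrite -de /derive -E.
Qed.

Lemma is_derive_paster (V : normedModType R) (a t : R) (f g : R -> V) dg :
  a < t -> is_derive (t - a) 1 g dg -> is_derive t 1 (paste a f g) dg.
Proof.
move=> ta /is_derive_subr; apply: near_eq_is_derive; near=> x.
by rewrite /paste ifF //; apply/negbTE; rewrite -ltNge; near: x; exact: lt_nbhsr.
Unshelve. all: by end_near. Qed.

Lemma lip_on_paste (a b : R) (f g : R -> R) : 0 <= a -> 0 <= b -> f a = g 0 ->
  lip_on 0 a f -> lip_on 0 b g -> lip_on 0 (a + b) (paste a f g).
Proof.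
move=> a0 b0 fg [K K0 fK] [M M0 gM]; exists (K + M); first exact: addr_ge0.
suff H s t : s <= t -> 0 <= s -> t <= a + b ->
    `|paste a f g s - paste a f g t| <= (K + M) * `|s - t|.
  move=> s t /andP[s0 sb] /andP[t0 tb]; have [st|/ltW st] := leP s t.
    exact: H.
  by rewrite distrC (distrC s); exact: H.
move=> st s0 tb; have E : `|s - t| = t - s by rewrite distrC ger0_norm // subr_ge0.
rewrite E /paste; have [ta|at_] := leP t a; have [sa|as_] := leP s a.
- have := fK s t; rewrite E mulrDl => h.
  by apply: le_trans (h _ _) _; rewrite ?lerDl ?mulr_ge0 ?subr_ge0 //; apply/andP; split; lra.
- lra.
(* Here the junction separates [s] from [t]; the increment is split at the common value
   [f a = g 0]. *)
- have h1 : `|f s - f a| <= K * (a - s).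
    by have := fK s a; rewrite (distrC s) (ger0_norm (x := a - s)) ?subr_ge0 //; apply; apply/andP; split; lra.
  have h2 : `|g 0 - g (t - a)| <= M * (t - a).
    have ta0 : 0 <= t - a by lra.
    have := gM 0 (t - a); rewrite sub0r normrN (ger0_norm ta0).
    by apply; apply/andP; split; lra.
  have := ler_normD (f s - f a) (g 0 - g (t - a)); rewrite -fg subrKA.
  rewrite -fg in h2; nra.
- have := gM (s - a) (t - a); rewrite opprB addrA subrK E => h.
  rewrite mulrDl.
  by apply: le_trans (h _ _) _; rewrite ?lerDr ?mulr_ge0 ?subr_ge0 //; apply/andP; split; lra.
Qed.

Lemma mlip_on_paste m n (a b : R) (F G : R -> 'M[R]_(m, n)) :
  0 <= a -> 0 <= b -> F a = G 0 ->
  mlip_on 0 a F -> mlip_on 0 b G -> mlip_on 0 (a + b) (paste a F G).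
Proof.
move=> a0 b0 FG lF lG i j.
have := lip_on_paste a0 b0 (congr1 (fun A : 'M[R]_(m, n) => A i j) FG) (lF i j) (lG i j).
by congr lip_on; apply/funext => t; rewrite /paste; case: ifP.
Qed.

Lemma measurable_paste (a : R) (u v : R -> R) :
  measurable_fun [set: R] u -> measurable_fun [set: R] v ->
  measurable_fun [set: R] (paste a u v).
Proof.
move=> mu mv; apply: measurable_fun_ifT => //.
- by apply: measurable_fun_ler.
- apply: (measurableT_comp mv); exact: measurable_funB.
Qed.

Lemma bounded_in_Linfty (T K : R) (u : R -> R) :
  measurable_fun [set: R] u -> (forall t, `|u t| <= K) -> in_Linfty T u.
Proof.
move=> mu uK; rewrite /in_Linfty; apply/andP; split.
  rewrite inE /=; have D : measurable `]0, T[ by exact: measurable_itv.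
  have uD : measurable_fun `]0, T[ u by exact: measurable_funTS.
  exact: (iffLR (measurable_restrictT u D) uD).
rewrite inE /= /finite_norm unlock /Lnorm.
case: ifPn => // _; apply: (@le_lt_trans _ _ K%:E); last exact: ltry.
apply/ess_supP; apply: aeW => x /=; rewrite lee_fin /patch; case: ifP => // _.
by rewrite normr0; apply: le_trans (uK 0).
Qed.

End Paste.

(** * Trajectories and their uniqueness *)

Local Open Scope quotient_scope.

(** * The group SE(3) in block form *)

Section SE3.
Variable R : realType.

Definition se (Q : 'M[R]_3) (x : 'cV[R]_3) : 'M[R]_4 :=
  block_mx Q x (0 : 'rV[R]_3) (1%:M : 'M[R]_1).

Lemma se_mul (Q Q' : 'M[R]_3) (x x' : 'cV[R]_3) :
  se Q x *m se Q' x' = se (Q *m Q') (Q *m x' + x).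
Proof.
apply: etrans (mulmx_block Q x (0 : 'rV[R]_3) (1%:M : 'M[R]_1) Q' x' 0 1%:M) _.
by rewrite !mulmx0 !mulmx1 !mul0mx !addr0 add0r.
Qed.

Lemma se1 : se 1%:M 0 = 1%:M.
Proof. exact: (esym (@scalar_mx_block R 3 1 1)). Qed.

Lemma in_SO3M (Q Q' : 'M[R]_3) : in_SO3 Q -> in_SO3 Q' -> in_SO3 (Q *m Q').
Proof.
move=> [Q1 dQ] [Q'1 dQ']; split; last by rewrite det_mulmx dQ dQ' mulr1.
by rewrite trmx_mul mulmxA -(mulmxA _ _ Q) Q1 mulmx1.
Qed.

Lemma in_SO3_trr (Q : 'M[R]_3) : in_SO3 Q -> Q *m Q^T = 1%:M.
Proof. by case=> /mulmx1C. Qed.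

Lemma in_SO3T (Q : 'M[R]_3) : in_SO3 Q -> in_SO3 Q^T.
Proof. by move=> SQ; split; rewrite ?trmxK ?in_SO3_trr // det_tr; case: SQ. Qed.

Lemma in_SE3_se (Q : 'M[R]_3) (x : 'cV[R]_3) : in_SO3 Q -> in_SE3 (se Q x).
Proof. by exists Q, x. Qed.

Lemma in_SE3M (g h : 'M[R]_4) : in_SE3 g -> in_SE3 h -> in_SE3 (g *m h).
Proof.
move=> [Q [x [SQ ->]]] [Q' [x' [SQ' ->]]].
rewrite -/(se Q x) -/(se Q' x') se_mul; apply: in_SE3_se; exact: in_SO3M.
Qed.

Lemma in_SE3_inv (g : 'M[R]_4) : in_SE3 g ->
  exists2 h, in_SE3 h & g *m h = 1%:M /\ h *m g = 1%:M.
Proof.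
move=> [Q [x [SQ ->]]]; rewrite -/(se Q x).
exists (se Q^T (- (Q^T *m x))); first exact/in_SE3_se/in_SO3T.
rewrite !se_mul mulmxN mulmxA in_SO3_trr // mul1mx addNr addrN.
by case: SQ => -> _; rewrite se1.
Qed.

Lemma in_SE3_unit (g : 'M[R]_4) : in_SE3 g -> g \in unitmx.
Proof. by move/in_SE3_inv => [h _ [/mulmx1_unit[]]]. Qed.

End SE3.

(** * Trajectories: concatenation, uniqueness, reachability *)

Section Trajectories.
Variable R : realType.
Variables Cpar Cperp Ctau L : R.

Definition body_velocity (th ph a b : R) : 'M[R]_4 :=
  se3_of (a *: v1_coord Cpar Cperp Ctau L th ph +
          b *: v2_coord Cpar Cperp Ctau L th ph).

(* [ph] is a real lift of the second shape variable, and [gi] the inverse of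
   [g]; carrying [gi] along makes uniqueness a one-line computation. *)
Record trajectory (T : R) (u1 u2 th ph : R -> R) (g gi : R -> 'M[R]_4) : Prop :=
  Trajectory {
    traj_gt0 : 0 < T;
    traj_measurable1 : measurable_fun [set: R] u1;
    traj_measurable2 : measurable_fun [set: R] u2;
    traj_bounded1 : exists K : R, forall t, `|u1 t| <= K;
    traj_bounded2 : exists K : R, forall t, `|u2 t| <= K;
    traj_th : lip_on 0 T th;
    traj_ph : lip_on 0 T ph;
    traj_g : mlip_on 0 T g;
    traj_gi : mlip_on 0 T gi;
    traj_SE3 : forall t : R, 0 <= t <= T -> in_SE3 (g t);
    traj_inv : forall t : R, 0 <= t <= T -> g t *m gi t = 1%:M;
    traj_ode : exists E : seq R, forall t : R, 0 < t < T -> t \notin E ->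
      [/\ is_derive t 1 th (u2 t), is_derive t 1 ph (u1 t),
          is_derive t 1 g (g t *m body_velocity (th t) (ph t) (u1 t) (u2 t)) &
          is_derive t 1 gi (- (body_velocity (th t) (ph t) (u1 t) (u2 t) *m gi t))]
  }.

Lemma bounded_paste (a : R) (u v : R -> R) :
  (exists K : R, forall t, `|u t| <= K) -> (exists K, forall t, `|v t| <= K) ->
  exists K : R, forall t, `|paste a u v t| <= K.
Proof.
move=> [K uK] [M vM]; exists (Num.max K M) => t; rewrite le_max /paste.
by case: ifP => _; rewrite ?uK ?vM ?orbT.
Qed.

Lemma trajectory_paste T u1 u2 th ph g gi T' u1' u2' th' ph' g' gi' :
  trajectory T u1 u2 th ph g gi -> trajectory T' u1' u2' th' ph' g' gi' ->
  th T = th' 0 -> ph T = ph' 0 -> g T = g' 0 ->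
  trajectory (T + T') (paste T u1 u1') (paste T u2 u2') (paste T th th')
    (paste T ph ph') (paste T g g') (paste T gi gi').
Proof.
case=> T0 m1 m2 b1 b2 lth lph lg lgi gS ginv [E ode].
case=> T0' m1' m2' b1' b2' lth' lph' lg' lgi' gS' ginv' [E' ode'] eth eph eg.
(* The inverse curves match automatically, an inverse being unique. *)
have egi : gi T = gi' 0.
  have h1 : g T *m gi T = 1%:M by apply: ginv; rewrite ltW ?lexx.
  have h2 : g T *m gi' 0 = 1%:M by rewrite eg; apply: ginv'; rewrite lexx ltW.
  by rewrite -[LHS]mulmx1 -h2 mulmxA (mulmx1C h1) mul1mx.
have shift (t : R) : t <= T + T' -> T < t -> 0 <= t - T <= T'.
  by move=> h1 h2; apply/andP; split; lra.
have TT := ltW T0; have TT' := ltW T0'.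
split.
- exact: addr_gt0.
- exact: measurable_paste.
- exact: measurable_paste.
- exact: bounded_paste.
- exact: bounded_paste.
- exact: lip_on_paste.
- exact: lip_on_paste.
- exact: mlip_on_paste.
- exact: mlip_on_paste.
- move=> t /andP[t0 tT]; rewrite /paste; have [tT'|Tt] := leP t T.
    by apply: gS; rewrite t0.
  exact/gS'/shift.
- move=> t /andP[t0 tT]; rewrite /paste; have [tT'|Tt] := leP t T.
    by apply: ginv; rewrite t0.
  exact/ginv'/shift.
(* The junction time is exceptional as well, since the control may jump there. *)
- exists (T :: E ++ map (fun x => x + T) E') => t /andP[t0 tT].
  rewrite inE mem_cat !negb_or => /and3P[tnT tE tE'].
  have [tlT|Tlt|tE0] := ltgtP t T; last by rewrite tE0 eqxx in tnT.
    have [|d1 d2 d3 d4] := ode t _ tE; first by rewrite t0.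
    have e (X : Type) (f h : R -> X) : paste T f h t = f t by rewrite /paste ltW.
    by rewrite !e; split; apply: is_derive_pastel.
  have tTE : t - T \notin E'.
    apply: contra tE' => h; apply/mapP; exists (t - T) => //; by rewrite subrK.
  have [|d1 d2 d3 d4] := ode' (t - T) _ tTE; first by apply/andP; split; lra.
  have e (X : Type) (f h : R -> X) : paste T f h t = h (t - T).
    by rewrite /paste leNgt Tlt.
  by rewrite !e; split; apply: is_derive_paster.
Qed.

Lemma trajectory_solution T u1 u2 th ph g gi :
  trajectory T u1 u2 th ph g gi ->
  is_solution Cpar Cperp Ctau L T u1 u2 g
    (fun t => (th t, \pi_(circle R) (ph t))).
Proof.
case=> T0 m1 m2 b1 b2 lth lph lg lgi gS ginv [E ode].
have FF : Filter (almost_everywhere (@lebesgue_measure R)).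
  exact: ae_filter_ringOfSetsType.
have oT (t : R) : t \in `]0, T[ -> 0 < t < T by rewrite in_itv.
split.
- split; first exact: abs_cont_mlip.
  by move=> t; rewrite in_itv; exact: gS.
- have := ae_finite E; apply: filterS => t tE /oT t0T.
  have [_ _ dg _] := ode t t0T tE; split; first by case: dg.
  have tT : 0 <= t <= T by case/andP: t0T => /ltW -> /ltW ->.
  have gu : g t \in unitmx by exact/in_SE3_unit/gS.
  by rewrite derive1E (@derive_val _ _ _ _ _ _ _ dg) mulKmx // v1E v2E.
- exists ph; split=> //; first exact: abs_cont_lip_on.
  by have := ae_finite E; apply: filterS => t tE /oT t0T; have [] := ode t t0T tE.
- exact: abs_cont_lip_on.
- by have := ae_finite E; apply: filterS => t tE /oT t0T; have [] := ode t t0T tE.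
Qed.

Lemma circle_piP (x y : R) :
  \pi_(circle R) x = \pi_(circle R) y -> exists k : int, x = y + k%:~R * (2 * pi).
Proof.
by move/eqP; rewrite eqmodE => /asboolP[k Hk]; exists k; rewrite -Hk addrC subrK.
Qed.

Lemma trajectory_unique T u1 u2 th ph g gi g' (s' : R -> Defs.shape R) :
  trajectory T u1 u2 th ph g gi ->
  is_solution Cpar Cperp Ctau L T u1 u2 g' s' ->
  g' 0 = g 0 -> s' 0 = (th 0, \pi_(circle R) (ph 0)) ->
  forall t, t \in `[0, T] -> g' t = g t /\ s' t = (th t, \pi_(circle R) (ph t)).
Proof.
case=> T0 m1 m2 b1 b2 lth lph lg lgi gS ginv [E ode].
case=> -[acg' gS'] dg' [l [acl lE dl]] acs ds g'0 s'0.
have FF : Filter (almost_everywhere (@lebesgue_measure R)).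
  exact: ae_filter_ringOfSetsType.
have oT (t : R) : t \in `]0, T[ -> 0 < t < T by rewrite in_itv.
have oc (t : R) : t \in `]0, T[ -> t \in `[0, T].
  by rewrite !in_itv /= => /andP[/ltW -> /ltW ->].
have cT (t : R) : t \in `[0, T] -> 0 <= t <= T by rewrite in_itv.
have i0 : 0 \in `[0, T] by rewrite in_itv /= lexx ltW.
have abs_contB f h : abs_cont 0 T f -> lip_on 0 T h -> abs_cont 0 T (fun t => f t - h t).
  move=> acf lh; apply: abs_contD => //; apply: abs_cont_lip_on.
  have := lip_onM (lip_on_cst 0 T (-1)) lh.
  by under eq_fun do rewrite mulN1r.
have sth t : t \in `[0, T] -> (s' t).1 = th t.
  move=> tT; apply/eqP; rewrite -subr_eq0; apply/eqP.
  have := @abs_cont_derive0 R 0 T (fun t => (s' t).1 - th t).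
  move=> /(_ (abs_contB _ _ acs lth)) -> //; first by rewrite s'0 subrr.
  move: ds (ae_finite E); apply: filterS2 => x dsx xE xT.
  have [dth _ _ _] := ode x (oT _ xT) xE.
  apply: (@is_derive_eq _ _ _ _ _ _ _ _ (is_deriveB (dsx xT) dth)).
  exact: subrr.
(* Two lifts of the same initial point differ by a multiple of [2 * pi]; having the same velocity,
   they keep that difference. *)
have [k lk] : exists k : int, l 0 = ph 0 + k%:~R * (2 * pi).
  by apply: circle_piP; rewrite -lE // s'0.
have lph' t : t \in `[0, T] -> l t = ph t + k%:~R * (2 * pi).
  move=> tT; apply/eqP; rewrite addrC -subr_eq; apply/eqP.
  have := @abs_cont_derive0 R 0 T (fun t => l t - ph t).
  move=> /(_ (abs_contB _ _ acl lph)) -> //; first by rewrite lk addrAC subrr add0r.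
  move: dl (ae_finite E); apply: filterS2 => x dlx xE xT.
  have [_ dph _ _] := ode x (oT _ xT) xE.
  apply: (@is_derive_eq _ _ _ _ _ _ _ _ (is_deriveB (dlx xT) dph)).
  exact: subrr.
have sE t : t \in `[0, T] -> s' t = (th t, \pi_(circle R) (ph t)).
  move=> tT; rewrite [LHS]surjective_pairing sth // lE //; congr (_, _).
  apply/eqmodP/asboolP; exists k.
  by rewrite lph' // addrAC subrr add0r.
(* The shapes agree by now, so [g'] and [gi] are driven by the same velocity [Y], and the two terms
   [g' Y gi] in the derivative of [g' gi] cancel. *)
have const i j t : t \in `[0, T] -> (g' t *m gi t) i j = (g' 0 *m gi 0) i j.
  apply: (@abs_cont_derive0 R 0 T (fun t => (g' t *m gi t) i j)).
    under eq_fun do rewrite mxE.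
    apply: (@abs_cont_sum R _ _ 0 T (fun m t => g' t i m * gi t m j)) => m.
    by apply: abs_contM; [exact: (@abs_cont_entry R 3 3 0 T g' i m acg') | exact: abs_cont_lip_on].
  move: dg' (ae_finite E); apply: filterS2 => x dgx xE xT.
  have [_ _ _ dgi] := ode x (oT _ xT) xE.
  have [dv] := dgx xT; rewrite sE ?oc // v1E v2E -/(body_velocity _ _ _ _) => dvE.
  have dg'x : is_derive x 1 g' (g' x *m body_velocity (th x) (ph x) (u1 x) (u2 x)).
    apply: DeriveDef => //; rewrite -derive1E -dvE mulKVmx //.
    exact/in_SE3_unit/gS'/oc.
  have := is_derive_mulmx dg'x dgi.
  by rewrite mulmxN mulmxA addrN => /is_derive_mxP/(_ i j); rewrite mxE.
move=> t tT; split; last exact: sE.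
have h1 : g' t *m gi t = 1%:M.
  rewrite -(ginv 0) ?cT // -g'0; apply/matrixP => i j; exact: const.
have h2 : g t *m gi t = 1%:M by apply/ginv/cT.
by rewrite -[LHS]mulmx1 -(mulmx1C h2) mulmxA h1 mul1mx.
Qed.

(** Reachability on the universal cover of the shape space: [ph0] and [ph1] are real numbers, not
    points of the circle. *)
Definition reach (g0 : 'M[R]_4) (th0 ph0 : R) (g1 : 'M[R]_4) (th1 ph1 : R) : Prop :=
  exists T u1 u2 th ph g gi,
    [/\ trajectory T u1 u2 th ph g gi,
        [/\ g 0 = g0, th 0 = th0 & ph 0 = ph0] &
        [/\ g T = g1, th T = th1 & ph T = ph1]].

Lemma reach_trans g0 th0 ph0 g1 th1 ph1 g2 th2 ph2 :
  reach g0 th0 ph0 g1 th1 ph1 -> reach g1 th1 ph1 g2 th2 ph2 ->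
  reach g0 th0 ph0 g2 th2 ph2.
Proof.
move=> [T [u1 [u2 [th [ph [g [gi [tr [a1 a2 a3] [b1 b2 b3]]]]]]]]].
move=> [T' [u1' [u2' [th' [ph' [g' [gi' [tr' [a1' a2' a3'] [b1' b2' b3']]]]]]]]].
have T0 := traj_gt0 tr; have T0' := traj_gt0 tr'.
have e0 (X : Type) (f h : R -> X) : paste T f h 0 = f 0 by rewrite /paste ltW.
have e1 (X : Type) (f h : R -> X) : paste T f h (T + T') = h T'.
  by rewrite /paste leNgt ltrDl T0' /= addrAC subrr add0r.
exists (T + T'), (paste T u1 u1'), (paste T u2 u2'), (paste T th th'), (paste T ph ph').
exists (paste T g g'), (paste T gi gi'); rewrite !e0 !e1; split => //.
by apply: trajectory_paste => //; congruence.
Qed.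

Lemma reach_control (g0 g1 : 'M[R]_4) (th0 ph0 th1 ph1 : R) :
  reach g0 th0 ph0 g1 th1 ph1 ->
  exists (T : R) (u1 u2 : R -> R),
      [/\ 0 < T, in_Linfty T u1, in_Linfty T u2 &
          exists (g : R -> 'M[R]_4) (s : R -> Defs.shape R),
            [/\ is_solution Cpar Cperp Ctau L T u1 u2 g s, g 0 = g0,
                s 0 = (th0, \pi_(circle R) ph0), g T = g1 &
                forall (g' : R -> 'M[R]_4) (s' : R -> Defs.shape R),
                  is_solution Cpar Cperp Ctau L T u1 u2 g' s' -> g' 0 = g0 ->
                  s' 0 = (th0, \pi_(circle R) ph0) ->
                  forall t, t \in `[0, T] -> g' t = g t /\ s' t = s t]].
Proof.
move=> [T [u1 [u2 [th [ph [g [gi [tr [a1 a2 a3] [b1 b2 b3]]]]]]]]].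
exists T, u1, u2; have [K1 uK1] := traj_bounded1 tr; have [K2 uK2] := traj_bounded2 tr.
split; first exact: traj_gt0 tr.
- exact: bounded_in_Linfty (traj_measurable1 tr) uK1.
- exact: bounded_in_Linfty (traj_measurable2 tr) uK2.
exists g, (fun t => (th t, \pi_(circle R) (ph t))); rewrite a2 a3; split => //.
  exact: trajectory_solution tr.
move=> g' s' sol e1 e2; apply: (trajectory_unique tr) => //; by rewrite ?a1 ?a2 ?a3.
Qed.

End Trajectories.

(** * Closed forms of the velocity fields *)

Section ResistanceMatrix.
Variable R : realType.

Lemma colseq6E (a b c d e f : R) : colseq 6 [:: a; b; c; d; e; f] =
  col_mx (colseq 3 [:: a; b; c]) (colseq 3 [:: d; e; f]) :> 'cV[R]_(3 + 3).
Proof.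
apply/colP => i; case: (split_ordP (i : 'I_(3 + 3))) => j ->.
  by rewrite col_mxEu !mxE; case: j => [[|[|[|//]]] ?].
by rewrite col_mxEd !mxE; case: j => [[|[|[|//]]] ?].
Qed.

Variables Cpar Cperp Ctau L : R.

(** With the product spelled out, a solution of a linear system in [resM] can be checked by
    substitution, without inverting a 6 by 6 matrix. *)
Lemma resM_mul (th ph u0 u1 u2 w0 w1 w2 : R) :
  let x := sin ph * cos th in let y := sin ph * sin th in let z := cos ph in
  let D := Cpar - Cperp in let k := L ^+ 2 / 2 * Cperp in
  let j := L ^+ 3 / 3 * Cperp in
  let eu := x * u0 + y * u1 + z * u2 in let ew := x * w0 + y * w1 + z * w2 in
  resM Cpar Cperp Ctau L th ph *m colseq 6 [:: u0; u1; u2; w0; w1; w2] =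
  colseq 6 [::
    L * (D * eu * x + 2 * Cperp * u0) - k * (y * w2 - (1 + z) * w1);
    L * (D * eu * y + 2 * Cperp * u1) - k * ((1 + z) * w0 - x * w2);
    L * (D * eu * z + D * u2 + 2 * Cperp * u2) - k * (x * w1 - y * w0);
    k * (y * u2 - (1 + z) * u1) + j * (2 * w0 - ew * x);
    k * ((1 + z) * u0 - x * u2) + j * (2 * w1 - ew * y);
    k * (x * u1 - y * u0) + j * (w2 - ew * z) + L * Ctau * w2].
Proof.
move=> x y z D k j eu ew; rewrite !colseq6E.
apply: etrans (@mul_block_col R 3 3 3 3 1 _ _ _ _ _ _) _.
have H (a b c d e f : R) (A B : 'M[R]_3) (u w v : 'cV[R]_3) :
  (forall i, (A *m u) i 0 + (B *m w) i 0 = v i 0) -> A *m u + B *m w = v.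
  by move=> h; apply/colP => i; rewrite mxE h.
by congr col_mx; apply: H => // -[[|[|[|//]]] ?];
  rewrite !mxE !big_ord_recr !big_ord0 /= !mxE /=;
  rewrite /eu /ew /x /y /z /D /k /j; field.
Qed.

Lemma colseq_eta (v : 'cV[R]_6) : v =
  colseq 6 [:: v 0 0; v 1 0; v 2 0; v 3 0; v 4 0; v 5 0].
Proof.
by apply/colP => -[[|[|[|[|[|[|//]]]]]] ?]; rewrite mxE /=;
  congr (v _ _); apply: val_inj.
Qed.

Lemma colseq6_inj (a b c d e f a' b' c' d' e' f' : R) :
  colseq 6 [:: a; b; c; d; e; f] = colseq 6 [:: a'; b'; c'; d'; e'; f'] ->
  [/\ a = a', b = b' & c = c'] /\ [/\ d = d', e = e' & f = f'].
Proof.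
move=> h; have H i := congr1 (fun v : 'cV[R]_6 => v i 0) h.
have := (H 0, H 1, H 2, H 3, H 4, H 5).
by rewrite !mxE /= => -[[[[[-> ->] ->] ->] ->] ->].
Qed.

Hypotheses (Cpar0 : 0 < Cpar) (Cperp0 : 0 < Cperp) (Ctau0 : 0 < Ctau) (L0 : 0 < L).

Lemma unitmx_injP n (A : 'M[R]_n) : (forall v : 'cV_n, A *m v = 0 -> v = 0) ->
  A \in unitmx.
Proof.
move=> H; rewrite -unitmx_tr -row_free_unit -kermx_eq0.
apply/eqP/row_matrixP => i; rewrite row0; apply: trmx_inj; rewrite trmx0.
apply: H; apply: trmx_inj; rewrite trmx_mul trmxK trmx0.
by rewrite -row_mul mulmx_ker row0.
Qed.

(* The quadratic form of [resM] is a sum of squares: the rate of dissipation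
   integrated along the two links. *)
Lemma resM_unit (th ph : R) : resM Cpar Cperp Ctau L th ph \in unitmx.
Proof.
apply: unitmx_injP => v; rewrite (colseq_eta v).
move: (v 0 0) (v 1 0) (v 2 0) (v 3 0) (v 4 0) (v 5 0) => u0 u1 u2 w0 w1 w2.
have -> : 0 = colseq 6 [:: 0; 0; 0; 0; 0; 0] :> 'cV[R]_6.
  by apply/colP => -[[|[|[|[|[|[|//]]]]]] ?]; rewrite !mxE.
rewrite resM_mul => /colseq6_inj[[e0 e1 e2] [e3 e4 e5]].
pose x := sin ph * cos th; pose y := sin ph * sin th; pose z := cos ph.
pose eu := x * u0 + y * u1 + z * u2.
have ez : z ^+ 2 = 1 - x ^+ 2 - y ^+ 2.
  rewrite /x /y /z cos2sin2 !exprMn -addrA -opprD -mulrDr.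
  by rewrite cos2Dsin2 mulr1.
(* [D] and [d] are the velocities of the midpoints of the first and second link, transversal to the
   link; [b] is the cross product of the angular velocity with the second axis. The factor
   [L ^+ 3 / 12] below comes from integrating the squared distance to the midpoint. *)
pose D0 := u0 + L / 2 * w1; pose D1 := u1 - L / 2 * w0.
pose b0 := w1 * z - w2 * y; pose b1 := w2 * x - w0 * z; pose b2 := w0 * y - w1 * x.
pose d0 := u0 - eu * x + L / 2 * b0; pose d1 := u1 - eu * y + L / 2 * b1.
pose d2 := u2 - eu * z + L / 2 * b2.
have E : L * Cpar * (u2 ^+ 2 + eu ^+ 2)
   + L * Cperp * (D0 ^+ 2 + D1 ^+ 2 + (d0 ^+ 2 + d1 ^+ 2 + d2 ^+ 2))
   + L ^+ 3 * Cperp / 12 * (w0 ^+ 2 + w1 ^+ 2 + (b0 ^+ 2 + b1 ^+ 2 + b2 ^+ 2))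
   + L * Ctau * w2 ^+ 2 = 0.
  (* The six equations are paired with the six components of the velocity. *)
  transitivity (u0 * 0 + u1 * 0 + u2 * 0 + w0 * 0 + w1 * 0 + w2 * 0 : R);
    last by rewrite !mulr0 !addr0.
  rewrite -{1}e0 -{1}e1 -{1}e2 -{1}e3 -{1}e4 -e5 -/x -/y -/z.
  rewrite /d0 /d1 /d2 /D0 /D1 /b0 /b1 /b2 /eu.
  by field: ez.
have LP := mulr_gt0 L0 Cpar0; have LC := mulr_gt0 L0 Cperp0.
have LT := mulr_gt0 L0 Ctau0.
have L3 : 0 < L ^+ 3 * Cperp / 12 by rewrite divr_gt0 // mulr_gt0 // exprn_gt0.
have sq (t : R) : 0 <= t ^+ 2 by exact: sqr_ge0.
have z2 (a b : R) : 0 < a -> a * b ^+ 2 <= 0 -> b = 0.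
  move=> a0 h; apply/eqP; rewrite -sqrf_eq0 eq_le sq andbT.
  by rewrite -(pmulr_rle0 _ a0).
move: E; rewrite !mulrDr => E.
have P1 := mulr_ge0 (ltW LP) (sq u2); have P2 := mulr_ge0 (ltW LP) (sq eu).
have P3 := mulr_ge0 (ltW LC) (sq D0); have P4 := mulr_ge0 (ltW LC) (sq D1).
have P5 := mulr_ge0 (ltW LC) (sq d0); have P6 := mulr_ge0 (ltW LC) (sq d1).
have P7 := mulr_ge0 (ltW LC) (sq d2).
have P8 := mulr_ge0 (ltW L3) (sq w0); have P9 := mulr_ge0 (ltW L3) (sq w1).
have Q1 := mulr_ge0 (ltW L3) (sq b0); have Q2 := mulr_ge0 (ltW L3) (sq b1).
have Q3 := mulr_ge0 (ltW L3) (sq b2); have Q4 := mulr_ge0 (ltW LT) (sq w2).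
have w0E : w0 = 0 by apply: (z2 _ _ L3); lra.
have w1E : w1 = 0 by apply: (z2 _ _ L3); lra.
have w2E : w2 = 0 by apply: (z2 _ _ LT); lra.
have u2E : u2 = 0 by apply: (z2 _ _ LP); lra.
have D0E : D0 = 0 by apply: (z2 _ _ LC); lra.
have D1E : D1 = 0 by apply: (z2 _ _ LC); lra.
have u0E : u0 = 0 by move: D0E; rewrite /D0 w1E mulr0 addr0.
have u1E : u1 = 0 by move: D1E; rewrite /D1 w0E mulr0 subr0.
by rewrite w0E w1E w2E u0E u1E u2E.
Qed.

End ResistanceMatrix.

Section VelocityFields.
Variable R : realType.
Variables Cpar Cperp Ctau L : R.
Hypotheses (Cpar0 : 0 < Cpar) (Cperp0 : 0 < Cperp) (Ctau0 : 0 < Ctau) (L0 : 0 < L).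

Lemma sin_half (x : R) : sin x = 2 * sin (x / 2) * cos (x / 2).
Proof. by rewrite {1}[x]splitr sinD; ring. Qed.

Lemma cos_half (x : R) : cos x = cos (x / 2) ^+ 2 - sin (x / 2) ^+ 2.
Proof. by rewrite {1}[x]splitr cosD; ring. Qed.

(* Speed of the hinge along the bisector of the links per unit of d(ph)/dt, from
   the balance of the drag forces along the bisector. *)
Definition hinge_speed (ph : R) : R :=
  Cperp * L * sin (ph / 2) /
  (4 * (Cpar * cos (ph / 2) ^+ 2 + Cperp * sin (ph / 2) ^+ 2)).

(** A convex combination of two positive coefficients. *)
Lemma drag_bisector_gt0 (ph : R) :
  0 < Cpar * cos (ph / 2) ^+ 2 + Cperp * sin (ph / 2) ^+ 2.
Proof.
rewrite cos2sin2; have := sqr_ge0 (sin (ph / 2)).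
have : sin (ph / 2) ^+ 2 <= 1 by rewrite sin2cos2 gerBl sqr_ge0.
move: (sin (ph / 2) ^+ 2) => t t1; rewrite le_eqVlt => /predU1P[<-|t0].
  by rewrite subr0 mulr1 mulr0 addr0.
apply: ltr_wpDl; last exact: mulr_gt0.
by rewrite mulr_ge0 ?subr_ge0 // ltW.
Qed.

(** Multiplication by the invertible [resM] reduces the claim to identities between rational
    functions of the sines and cosines of [th] and [ph / 2]. *)
Lemma v1_coordE (th ph : R) : v1_coord Cpar Cperp Ctau L th ph =
  colseq 6 [:: hinge_speed ph * sin (ph / 2) * cos th;
               hinge_speed ph * sin (ph / 2) * sin th;
               hinge_speed ph * cos (ph / 2); sin th / 2; - cos th / 2; 0].
Proof.
have A0 := lt0r_neq0 (drag_bisector_gt0 ph).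
have uM := resM_unit Cpar0 Cperp0 Ctau0 L0 th ph.
apply: (can_inj (mulKmx uM)); rewrite mulKVmx // resM_mul (sin_half ph) (cos_half ph) /hinge_speed.
have ec := cos2sin2 (ph / 2); have et := cos2sin2 th.
move: A0 ec et; move: (sin (ph / 2)) (cos (ph / 2)) (sin th) (cos th) => s c st ct.
move=> A0 ec et.
by congr (colseq 6 [:: _; _; _; _; _; _]); field: ec et.
Qed.

(* Up to adding the rotation [e_z] of [th] itself, [v2] is the response of the rigid
   V-shape to a torque along the first link; [tilt_rate] is its magnitude relative
   to the vector [(- 4 s^3, 0, c^3)] in the frame of the bisector. *)
Definition tilt_rate (ph : R) : R := 3 * Ctau /
  (2 * L ^+ 2 * Cperp * (sin (ph / 2) * cos (ph / 2)) ^+ 2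
   + 3 * Ctau * (cos (ph / 2) ^+ 4 + 4 * sin (ph / 2) ^+ 4)).

(** With [t = sin (ph / 2) ^+ 2], the last bracket is [(1 - t)^2 + 4 t^2], which has no real
    zero. *)
Lemma tilt_den_gt0 (ph : R) :
  0 < 2 * L ^+ 2 * Cperp * (sin (ph / 2) * cos (ph / 2)) ^+ 2
   + 3 * Ctau * (cos (ph / 2) ^+ 4 + 4 * sin (ph / 2) ^+ 4).
Proof.
apply: ltr_wpDl.
  by apply: mulr_ge0; [rewrite ltW // !mulr_gt0 // exprn_gt0 | exact: sqr_ge0].
apply: mulr_gt0; first by rewrite mulr_gt0.
have -> : cos (ph / 2) ^+ 4 = (1 - sin (ph / 2) ^+ 2) ^+ 2.
  by rewrite -cos2sin2 -exprM.
have -> : sin (ph / 2) ^+ 4 = (sin (ph / 2) ^+ 2) ^+ 2 by rewrite -exprM.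
move: (sin (ph / 2) ^+ 2) => t; nra.
Qed.

Lemma v2_coordE (th ph : R) : v2_coord Cpar Cperp Ctau L th ph =
  let s := sin (ph / 2) in let c := cos (ph / 2) in let k := tilt_rate ph in
  colseq 6 [:: 2 * k * L * s ^+ 3 * c * sin th; - 2 * k * L * s ^+ 3 * c * cos th; 0;
    k * (s * c ^+ 3 - 4 * s ^+ 3 * c) * cos th;
    k * (s * c ^+ 3 - 4 * s ^+ 3 * c) * sin th;
    k * (c ^+ 4 + 4 * s ^+ 4) - 1].
Proof.
rewrite /tilt_rate; set s0 := sin (ph / 2); set c0 := cos (ph / 2); cbv zeta.
have A0 := lt0r_neq0 (tilt_den_gt0 ph).
have uM := resM_unit Cpar0 Cperp0 Ctau0 L0 th ph.
apply: (can_inj (mulKmx uM)); rewrite mulKVmx //.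
have s2 : sin (2 * ph) = 2 * sin ph * cos ph.
  by rewrite mulr_natl sin_mulr2n; ring.
rewrite resM_mul s2 (sin_half ph) (cos_half ph); rewrite -/s0 -/c0 in A0 *.
have ec : c0 ^+ 2 = 1 - s0 ^+ 2 := cos2sin2 (ph / 2).
have et := cos2sin2 th.
move: A0 ec et; move: s0 c0 (sin th) (cos th) => s c st ct A0 ec et.
by congr (colseq 6 [:: _; _; _; _; _; _]); field: ec et.
Qed.

End VelocityFields.

(** * Bending and spinning *)

Section Frames.
Variable R : realType.

Definition rz (a b : R) : 'M[R]_3 :=
  mxseq 3 3 [:: [:: a; - b; 0]; [:: b; a; 0]; [:: 0; 0; 1]].

(** The parameter is a point of the unit circle rather than an angle, because the axis of a spin is
    given by such a point. *)
Definition ry (a b : R) : 'M[R]_3 :=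
  mxseq 3 3 [:: [:: a; 0; - b]; [:: 0; 1; 0]; [:: b; 0; a]].

Definition zmat (a b : R) : 'M[R]_4 :=
  mxseq 4 4 [:: [:: a; - b; 0; 0]; [:: b; a; 0; 0]; [:: 0; 0; 1; 0]; [:: 0; 0; 0; 1]].

Definition rotz (t : R) := zmat (cos t) (sin t).

(* Rotation about the y-axis taking e_z to (-b, 0, a), then translation by
   z e_z; [ymat_inv] is its inverse when a^2 + b^2 = 1. *)
Definition ymat (a b z : R) : 'M[R]_4 :=
  mxseq 4 4 [:: [:: a; 0; - b; 0]; [:: 0; 1; 0; 0]; [:: b; 0; a; z]; [:: 0; 0; 0; 1]].

Definition ymat_inv (a b z : R) : 'M[R]_4 :=
  mxseq 4 4 [:: [:: a; 0; b; - (b * z)]; [:: 0; 1; 0; 0]; [:: - b; 0; a; - (a * z)];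
                [:: 0; 0; 0; 1]].

Definition ez_hat : 'M[R]_4 :=
  mxseq 4 4 [:: [:: 0; - 1; 0; 0]; [:: 1; 0; 0; 0]; [:: 0; 0; 0; 0]; [:: 0; 0; 0; 0]].

Ltac mx4 := apply/matrixP => -[[|[|[|[|//]]]] ?] -[[|[|[|[|//]]]] ?];
  rewrite !mxE ?big_ord_recr ?big_ord0 /= ?mxE /=.

Lemma se_eqP (g : 'M[R]_4) (Q : 'M[R]_3) (x : 'cV[R]_3) :
  (forall i j : 'I_3, g (lshift 1 i) (lshift 1 j) = Q i j) ->
  (forall i : 'I_3, g (lshift 1 i) (rshift 3 (0 : 'I_1)) = x i 0) ->
  (forall j : 'I_3, g (rshift 3 (0 : 'I_1)) (lshift 1 j) = 0) -> g (rshift 3 (0 : 'I_1)) (rshift 3 (0 : 'I_1)) = 1 ->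
  g = se Q x.
Proof.
move=> ul ur dl dr; apply/matrixP => i j.
case: (split_ordP (i : 'I_(3 + 1))) => i' ->; case: (split_ordP (j : 'I_(3 + 1))) => j' ->.
- by rewrite ul; apply/esym; exact: block_mxEul.
- by rewrite (ord1 j') ur; apply/esym; exact: block_mxEur.
- rewrite (ord1 i') dl; apply/esym; apply: etrans (block_mxEdl _ _ _ _ _ _) _.
  by rewrite mxE.
- rewrite (ord1 i') (ord1 j') dr; apply/esym; apply: etrans (block_mxEdr _ _ _ _ _ _) _.
  by rewrite mxE.
Qed.

Ltac se_entries := apply: se_eqP; [move=> -[[|[|[|//]]] ?] -[[|[|[|//]]] ?]
  |move=> -[[|[|[|//]]] ?] |move=> -[[|[|[|//]]] ?] | ]; by rewrite !mxE.

Lemma zmatE (a b : R) : zmat a b = se (rz a b) 0.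
Proof. by se_entries. Qed.

Lemma ymatE (a b z : R) : ymat a b z =
  se (ry a b) (colseq 3 [:: 0; 0; z]).
Proof. by se_entries. Qed.

Lemma det_mxseq3 (a b c d e f g h i : R) :
  \det (mxseq 3 3 [:: [:: a; b; c]; [:: d; e; f]; [:: g; h; i]]) =
  a * (e * i - f * h) - b * (d * i - f * g) + c * (d * h - e * g).
Proof.
rewrite (expand_det_row _ 0) !big_ord_recr big_ord0 /= /cofactor.
rewrite !(expand_det_row _ 0) !big_ord_recr !big_ord0 /= /cofactor !det_mx11 !mxE /=.
by rewrite /bump /=; ring.
Qed.

Lemma in_SO3_z (a b : R) : a ^+ 2 + b ^+ 2 = 1 ->
  in_SO3 (rz a b).
Proof.
move=> ab; have e : a ^+ 2 = 1 - b ^+ 2 by rewrite -ab addrK.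
split; last by rewrite det_mxseq3; ring: e.
apply/matrixP => -[[|[|[|//]]] ?] -[[|[|[|//]]] ?];
  by rewrite !mxE !big_ord_recr big_ord0 /= !mxE /=; ring: e.
Qed.

Lemma in_SO3_y (a b : R) : a ^+ 2 + b ^+ 2 = 1 ->
  in_SO3 (ry a b).
Proof.
move=> ab; have e : a ^+ 2 = 1 - b ^+ 2 by rewrite -ab addrK.
split; last by rewrite det_mxseq3; ring: e.
apply/matrixP => -[[|[|[|//]]] ?] -[[|[|[|//]]] ?];
  by rewrite !mxE !big_ord_recr big_ord0 /= !mxE /=; ring: e.
Qed.

Lemma in_SE3_rotz (t : R) : in_SE3 (rotz t).
Proof. by rewrite /rotz zmatE; apply: in_SE3_se; apply: in_SO3_z; exact: cos2Dsin2. Qed.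

Lemma in_SE3_ymat (a b z : R) : a ^+ 2 + b ^+ 2 = 1 -> in_SE3 (ymat a b z).
Proof. by move=> ab; rewrite ymatE; apply: in_SE3_se; exact: in_SO3_y. Qed.

Lemma rotzD (s t : R) : rotz s *m rotz t = rotz (s + t).
Proof. by mx4; rewrite ?cosD ?sinD; ring. Qed.

Lemma rotz0 : rotz 0 = 1%:M.
Proof. by mx4; rewrite ?cos0 ?sin0 ?oppr0. Qed.

Lemma rotzNK (t : R) : rotz (- t) *m rotz t = 1%:M.
Proof. by rewrite rotzD addNr rotz0. Qed.

Lemma rotzKN (t : R) : rotz t *m rotz (- t) = 1%:M.
Proof. by rewrite rotzD addrN rotz0. Qed.

Lemma ymatK (a b z : R) : a ^+ 2 + b ^+ 2 = 1 -> ymat a b z *m ymat_inv a b z = 1%:M.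
Proof.
move=> ab; have e : a ^+ 2 = 1 - b ^+ 2 by rewrite -ab addrK.
by mx4; ring: e.
Qed.

Lemma ymat_invK (a b z : R) : a ^+ 2 + b ^+ 2 = 1 -> ymat_inv a b z *m ymat a b z = 1%:M.
Proof. by move=> ab; apply/mulmx1C/ymatK. Qed.

Lemma se3_of_colseq (a b c d e f : R) : se3_of (colseq 6 [:: a; b; c; d; e; f]) =
  mxseq 4 4 [:: [:: 0; - f; e; a]; [:: f; 0; - d; b]; [:: - e; d; 0; c]; [:: 0; 0; 0; 0]].
Proof.
by rewrite /se3_of !mxE.
Qed.

Lemma rotz_ez_hat (t : R) : rotz t *m ez_hat = ez_hat *m rotz t.
Proof. by mx4; ring. Qed.

Lemma se3_ofD (u v : 'cV[R]_6) (a b : R) :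
  se3_of (a *: u + b *: v) = a *: se3_of u + b *: se3_of v.
Proof. by mx4; ring. Qed.

(** Adjoint action of a rotation about the z-axis: the linear and the angular part are turned alike.
    This is what factors [th] out of the velocity fields. *)
Lemma se3_of_rotz (a b c d e f t : R) :
  se3_of (colseq 6 [:: a * cos t - b * sin t; a * sin t + b * cos t; c;
                       d * cos t - e * sin t; d * sin t + e * cos t; f]) =
  rotz t *m se3_of (colseq 6 [:: a; b; c; d; e; f]) *m rotz (- t).
Proof.
have ct := cos2sin2 t; rewrite !se3_of_colseq; set Y := (Y in Y = _); set X := mxseq 4 4 [:: [:: 0; - f; _; _]; _; _; _].
have <- : Y *m rotz t = rotz t *m X by mx4; ring: ct.
by rewrite -mulmxA rotzKN mulmx1.
Qed.

(** Conjugation moves the axis of the generator to the line through [(0, 0, z)] with direction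
    [(- b, 0, a)]; the linear part is the moment of that line. *)
Lemma ymat_ez_hat (a b z : R) : a ^+ 2 + b ^+ 2 = 1 ->
  ymat a b z *m ez_hat *m ymat_inv a b z =
  se3_of (colseq 6 [:: 0; - (b * z); 0; - b; 0; a]).
Proof.
move=> ab; have e : a ^+ 2 = 1 - b ^+ 2 by rewrite -ab addrK.
rewrite se3_of_colseq; set X := (X in _ = X); have -> : ymat a b z *m ez_hat = X *m ymat a b z by mx4; ring: e.
by rewrite -mulmxA ymatK // mulmx1.
Qed.

Lemma is_derive_zmat (a b : R -> R) (da db t : R) :
  is_derive t 1 a da -> is_derive t 1 b db ->
  is_derive t 1 (fun x => zmat (a x) (b x))
    (mxseq 4 4 [:: [:: da; - db; 0; 0]; [:: db; da; 0; 0]; [:: 0; 0; 0; 0]; [:: 0; 0; 0; 0]]).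
Proof.
move=> Ha Hb; apply/is_derive_mxP => -[[|[|[|[|//]]]] ?] -[[|[|[|[|//]]]] ?];
  under eq_fun do rewrite mxE /=; rewrite mxE /=;
  by [exact: is_derive_cst | exact: Ha | exact: Hb | exact: is_deriveN].
Qed.

Lemma is_derive_ymat (a b z : R -> R) (da db dz t : R) :
  is_derive t 1 a da -> is_derive t 1 b db -> is_derive t 1 z dz ->
  is_derive t 1 (fun x => ymat (a x) (b x) (z x))
    (mxseq 4 4 [:: [:: da; 0; - db; 0]; [:: 0; 0; 0; 0]; [:: db; 0; da; dz]; [:: 0; 0; 0; 0]]).
Proof.
move=> Ha Hb Hz; apply/is_derive_mxP => -[[|[|[|[|//]]]] ?] -[[|[|[|[|//]]]] ?];
  under eq_fun do rewrite mxE /=; rewrite mxE /=;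
  by [exact: is_derive_cst | exact: Ha | exact: Hb | exact: Hz | exact: is_deriveN].
Qed.

Lemma is_derive_ymat_inv (a b z : R -> R) (da db dz t : R) :
  is_derive t 1 a da -> is_derive t 1 b db -> is_derive t 1 z dz ->
  is_derive t 1 (fun x => ymat_inv (a x) (b x) (z x))
    (mxseq 4 4 [:: [:: da; 0; db; - (db * z t + b t * dz)]; [:: 0; 0; 0; 0];
                   [:: - db; 0; da; - (da * z t + a t * dz)]; [:: 0; 0; 0; 0]]).
Proof.
move=> Ha Hb Hz; apply/is_derive_mxP => -[[|[|[|[|//]]]] ?] -[[|[|[|[|//]]]] ?];
  under eq_fun do rewrite mxE /=; rewrite mxE /=;
  try by [exact: is_derive_cst | exact: Ha | exact: Hb | exact: Hz | exact: is_deriveN].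
- apply: is_deriveN; apply: (@is_derive_eq _ _ _ _ _ _ _ _ (is_deriveM Hb Hz)).
  by rewrite /GRing.scale /=; ring.
- apply: is_deriveN; apply: (@is_derive_eq _ _ _ _ _ _ _ _ (is_deriveM Ha Hz)).
  by rewrite /GRing.scale /=; ring.
Qed.

Lemma lip_onN (p q : R) f : lip_on p q f -> lip_on p q (fun t => - f t).
Proof.
by move=> lf; have := lip_onM (lip_on_cst p q (-1)) lf; under eq_fun do rewrite mulN1r.
Qed.

Lemma mlip_zmat (p q : R) (a b : R -> R) : lip_on p q a -> lip_on p q b ->
  mlip_on p q (fun t => zmat (a t) (b t)).
Proof.
move=> la lb -[[|[|[|[|//]]]] ?] -[[|[|[|[|//]]]] ?];
  under eq_fun do rewrite mxE /=;
  by [exact: lip_on_cst | exact: la | exact: lb | exact: lip_onN].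
Qed.

Lemma mlip_ymat (p q : R) (a b z : R -> R) :
  lip_on p q a -> lip_on p q b -> lip_on p q z ->
  mlip_on p q (fun t => ymat (a t) (b t) (z t)).
Proof.
move=> la lb lz -[[|[|[|[|//]]]] ?] -[[|[|[|[|//]]]] ?];
  under eq_fun do rewrite mxE /=;
  by [exact: lip_on_cst | exact: la | exact: lb | exact: lz | exact: lip_onN].
Qed.

Lemma mlip_ymat_inv (p q : R) (a b z : R -> R) :
  lip_on p q a -> lip_on p q b -> lip_on p q z ->
  mlip_on p q (fun t => ymat_inv (a t) (b t) (z t)).
Proof.
move=> la lb lz -[[|[|[|[|//]]]] ?] -[[|[|[|[|//]]]] ?];
  under eq_fun do rewrite mxE /=;
  by [exact: lip_on_cst | exact: la | exact: lb | exact: lz | exact: lip_onN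
     | apply: lip_onN; exact: lip_onM].
Qed.

Lemma is_derive_affine (f : R -> R) (df t a b : R) :
  is_derive (a + t * b) 1 f df ->
  is_derive t 1 (fun x => f (a + x * b)) (b * df).
Proof.
move=> Hf; have H : is_derive t 1 (fun x : R => a + x * b) b.
  apply: (@is_derive_eq _ _ _ _ _ _ _ _ (is_deriveD (is_derive_cst a t 1)
    (is_deriveM (is_derive_id t 1) (is_derive_cst b t 1)))).
  by rewrite /GRing.scale /= mulr0 !add0r mulr1.
rewrite mulrC; exact: is_derive1_comp.
Qed.

End Frames.

(** * Trajectories that bend or spin the swimmer *)

Section Moves.
Variable R : realType.
Variables Cpar Cperp Ctau L : R.
Hypotheses (Cpar0 : 0 < Cpar) (Cperp0 : 0 < Cperp) (Ctau0 : 0 < Ctau) (L0 : 0 < L).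
Local Notation reach := (reach Cpar Cperp Ctau L).
Local Notation hinge_speed := (hinge_speed Cpar Cperp L).
Local Notation tilt_rate := (tilt_rate Cperp Ctau L).

Definition hat1 (p : R) : 'M[R]_4 := se3_of (v1_coord Cpar Cperp Ctau L 0 p).
Definition hat2 (p : R) : 'M[R]_4 := se3_of (v2_coord Cpar Cperp Ctau L 0 p).

Lemma hat1E (p : R) : hat1 p = mxseq 4 4
  [:: [:: 0; 0; - (1 / 2); hinge_speed p * sin (p / 2)]; [:: 0; 0; 0; 0];
      [:: 1 / 2; 0; 0; hinge_speed p * cos (p / 2)]; [:: 0; 0; 0; 0]].
Proof.
rewrite /hat1 v1_coordE // se3_of_colseq cos0 sin0.
by congr (mxseq 4 4 [:: [:: _; _; _; _]; [:: _; _; _; _]; [:: _; _; _; _]; _]); field.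
Qed.

(** The term [ez_hat] is the velocity of the frame [g rotz th] relative to [g] when [th] grows at
    unit speed. *)
Lemma hat2E (p : R) : hat2 p + ez_hat R =
  let s := sin (p / 2) in let c := cos (p / 2) in let k := tilt_rate p in
  mxseq 4 4
  [:: [:: 0; - (k * (c ^+ 4 + 4 * s ^+ 4)); 0; 0];
      [:: k * (c ^+ 4 + 4 * s ^+ 4); 0; - (k * (s * c ^+ 3 - 4 * s ^+ 3 * c));
          - 2 * k * L * s ^+ 3 * c];
      [:: 0; k * (s * c ^+ 3 - 4 * s ^+ 3 * c); 0; 0]; [:: 0; 0; 0; 0]].
Proof.
rewrite /hat2 v2_coordE // se3_of_colseq cos0 sin0 /=.
apply/matrixP => -[[|[|[|[|//]]]] ?] -[[|[|[|[|//]]]] ?]; rewrite !mxE /=; ring.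
Qed.

Lemma body_velocity_rotz (th p a b : R) :
  body_velocity Cpar Cperp Ctau L th p a b =
  rotz th *m (a *: hat1 p + b *: hat2 p) *m rotz (- th).
Proof.
rewrite /body_velocity se3_ofD mulmxDr mulmxDl -!scalemxAr -!scalemxAl.
have -> : se3_of (v1_coord Cpar Cperp Ctau L th p) = rotz th *m hat1 p *m rotz (- th).
  rewrite /hat1 !v1_coordE // cos0 sin0 -se3_of_rotz; congr se3_of.
  by congr (colseq 6 [:: _; _; _; _; _; _]); ring.
have -> : se3_of (v2_coord Cpar Cperp Ctau L th p) = rotz th *m hat2 p *m rotz (- th).
  rewrite /hat2 !v2_coordE // cos0 sin0 -se3_of_rotz; congr se3_of.
  by congr (colseq 6 [:: _; _; _; _; _; _]); ring.
by [].
Qed.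

Lemma is_derive_rotz (a b t : R) :
  is_derive t 1 (fun x => rotz (a + x * b)) (b *: (rotz (a + t * b) *m ez_hat R)).
Proof.
have dc := is_derive_affine (is_derive_cos (a + t * b)).
have ds := is_derive_affine (is_derive_sin (a + t * b)).
apply: (@is_derive_eq _ _ _ _ _ _ _ _ (is_derive_zmat dc ds)).
by apply/matrixP => -[[|[|[|[|//]]]] ?] -[[|[|[|[|//]]]] ?];
  rewrite !mxE ?big_ord_recr ?big_ord0 /= ?mxE /=; ring.
Qed.

Lemma is_derive_rotzN (a b t : R) :
  is_derive t 1 (fun x => rotz (- (a + x * b))) (- b *: (rotz (- (a + t * b)) *m ez_hat R)).
Proof.
have := is_derive_rotz (- a) (- b) t.
have E x : - a + x * - b = - (a + x * b) by ring.
by under eq_fun do rewrite E; rewrite E.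
Qed.

Lemma lip_on_affine (p q a b : R) (f df : R -> R) (K : R) :
  (forall t : R, is_derive t 1 f (df t)) -> (forall t, `|df t| <= K) ->
  lip_on p q (fun x => f (a + x * b)).
Proof.
move=> fd dfK; apply: (@lip_on_derive R p q _ (fun t => b * df (a + t * b)) (`|b| * K)).
  by move=> t; apply: is_derive_affine.
by move=> t; rewrite normrM ler_wpM2l.
Qed.

Lemma lip_on_id_affine (p q a b : R) : lip_on p q (fun x => a + x * b).
Proof.
apply: (lip_on_affine p q a b (f := id) (df := fun=> 1) (K := 1)) => t.
by rewrite normr1.
Qed.

Lemma lip_on_cos_affine (p q a b : R) : lip_on p q (fun x => cos (a + x * b)).
Proof.
apply: (lip_on_affine p q a b (@is_derive_cos R) (K := 1)) => t.
by rewrite normrN sin_max.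
Qed.

Lemma lip_on_sin_affine (p q a b : R) : lip_on p q (fun x => sin (a + x * b)).
Proof.
by apply: (lip_on_affine p q a b (@is_derive_sin R) (K := 1)) => t; exact: cos_max.
Qed.

Lemma mlip_rotz (p q a b : R) : mlip_on p q (fun x => rotz (a + x * b)).
Proof. by apply: mlip_zmat; [exact: lip_on_cos_affine | exact: lip_on_sin_affine]. Qed.

Lemma mlip_rotzN (p q a b : R) : mlip_on p q (fun x => rotz (- (a + x * b))).
Proof.
have E x : - (a + x * b) = - a + x * - b by ring.
by under eq_fun do rewrite E; exact: mlip_rotz.
Qed.

(* In the frame [H = g rotz th] attached to the plane of the two links, the
   velocity no longer depends on [th]. *)
Lemma reach_frame (b1 b2 th ph : R) (H Hi Y : R -> 'M[R]_4) :
  (forall t : R, is_derive t 1 H (H t *m Y t)) ->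
  (forall t : R, is_derive t 1 Hi (- (Y t *m Hi t))) ->
  mlip_on 0 1 H -> mlip_on 0 1 Hi ->
  (forall t, in_SE3 (H t)) -> (forall t, H t *m Hi t = 1%:M) ->
  (forall t, Y t = b1 *: hat1 (ph + t * b1) + b2 *: (hat2 (ph + t * b1) + ez_hat R)) ->
  reach (H 0 *m rotz (- th)) th ph (H 1 *m rotz (- (th + b2))) (th + b2) (ph + b1).
Proof.
move=> dH dHi lH lHi SH HHi YE.
(* Constant controls over unit time, so that [b1] and [b2] are the increments of [ph] and [th]. *)
exists 1, (fun=> b1), (fun=> b2), (fun t => th + t * b2), (fun t => ph + t * b1).
exists (fun t => H t *m rotz (- (th + t * b2))), (fun t => rotz (th + t * b2) *m Hi t).
have aff (a b t : R) : is_derive t 1 (fun x : R => a + x * b) b.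
  by have := is_derive_affine (is_derive_id (a + t * b) 1); rewrite mulr1.
split; last 2 first; rewrite ?mul0r ?mul1r ?addr0 //.
split.
- exact: ltr01.
- exact: measurable_cst.
- exact: measurable_cst.
- by exists `|b1|.
- by exists `|b2|.
- exact: lip_on_id_affine.
- exact: lip_on_id_affine.
- by apply: mlip_on_mul => //; exact: mlip_rotzN.
- by apply: mlip_on_mul => //; exact: mlip_rotz.
- by move=> t _; apply: in_SE3M => //; exact: in_SE3_rotz.
- by move=> t _; rewrite -mulmxA (mulmxA (rotz _)) rotzNK mul1mx.
exists [::] => t _ _; split; [exact: aff | exact: aff | | ].
- apply: (@is_derive_eq _ _ _ _ _ _ _ _ (is_derive_mulmx (dH t) (is_derive_rotzN th b2 t))).
  rewrite body_velocity_rotz !mulmxA -(mulmxA (H t)) rotzNK mulmx1 rotz_ez_hat.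
  have -> : b1 *: hat1 (ph + t * b1) + b2 *: hat2 (ph + t * b1) = Y t - b2 *: ez_hat R.
    by rewrite YE scalerDr addrA addrK.
  rewrite mulmxBr mulmxBl -!scalemxAr scaleNr mulmxA; congr (_ - _).
  exact: scalemxAl.
- apply: (@is_derive_eq _ _ _ _ _ _ _ _ (is_derive_mulmx (is_derive_rotz th b2 t) (dHi t))).
  rewrite body_velocity_rotz !mulmxA -(mulmxA _ (rotz _) (rotz _)) rotzNK mulmx1.
  have -> : b1 *: hat1 (ph + t * b1) + b2 *: hat2 (ph + t * b1) = Y t - b2 *: ez_hat R.
    by rewrite YE scalerDr addrA addrK.
  by rewrite mulmxBr mulmxBl opprB mulmxN mulmxA -!scalemxAr -!scalemxAl.
Qed.

(** Position of the hinge along the bisector, known through its derivative only; an explicit one is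
    supplied by [hinge_antiderivative]. *)
Variable d : R -> R.
Hypothesis dE : forall x : R, is_derive x 1 d (hinge_speed x).

(* Placement of the first link relative to the frame whose z-axis is the
   bisector of the two links. *)
Definition bis (p : R) := ymat (cos (p / 2)) (sin (p / 2)) (d p).
Definition bis_inv (p : R) := ymat_inv (cos (p / 2)) (sin (p / 2)) (d p).

(** Length of the vector [(- 4 s^3, 0, c^3)] along the axis of the spin, where [s] and [c] are the
    sine and cosine of [p / 2]. *)
Definition axis_norm (p : R) : R := Num.sqrt (16 * sin (p / 2) ^+ 6 + cos (p / 2) ^+ 6).
Definition axis_cos (p : R) : R := cos (p / 2) ^+ 3 / axis_norm p.
Definition axis_sin (p : R) : R := 4 * sin (p / 2) ^+ 3 / axis_norm p.
Definition axis_height (p : R) : R := d p + L / 2 * cos (p / 2).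

(* The z-axis of this frame is the axis of the spin at angle [p]. *)
Definition axis_frame (p : R) := ymat (axis_cos p) (axis_sin p) (axis_height p).
Definition axis_frame_inv (p : R) := ymat_inv (axis_cos p) (axis_sin p) (axis_height p).

Lemma axis_sq_gt0 (p : R) : 0 < 16 * sin (p / 2) ^+ 6 + cos (p / 2) ^+ 6.
Proof.
have -> : cos (p / 2) ^+ 6 = (1 - sin (p / 2) ^+ 2) ^+ 3 by rewrite -cos2sin2 -exprM.
have -> : sin (p / 2) ^+ 6 = (sin (p / 2) ^+ 2) ^+ 3 by rewrite -exprM.
have t1 : sin (p / 2) ^+ 2 <= 1 by rewrite sin2cos2 gerBl sqr_ge0.
move: t1 (sqr_ge0 (sin (p / 2))); move: (sin (p / 2) ^+ 2) => t t1.
rewrite le_eqVlt => /predU1P[<-|t0]; first by rewrite expr0n mulr0 subr0 expr1n add0r.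
by rewrite ltr_wpDr ?exprn_ge0 ?subr_ge0 // mulr_gt0 // exprn_gt0.
Qed.

Lemma axis_norm_gt0 (p : R) : 0 < axis_norm p.
Proof. by rewrite sqrtr_gt0 axis_sq_gt0. Qed.

Lemma axis_unit (p : R) : axis_cos p ^+ 2 + axis_sin p ^+ 2 = 1.
Proof.
rewrite /axis_cos /axis_sin !expr_div_n -mulrDl sqr_sqrtr ?ltW ?axis_sq_gt0 //.
have := lt0r_neq0 (axis_sq_gt0 p); move: (sin _) (cos _) => s c h.
by field.
Qed.

Lemma bis_unit (p : R) : cos (p / 2) ^+ 2 + sin (p / 2) ^+ 2 = 1.
Proof. exact: cos2Dsin2. Qed.

(** The denominator is 4 times a convex combination of [Cpar] and [Cperp], hence at least [4 * m].
    This makes [d] Lipschitz. *)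
Lemma hinge_speed_bounded : exists K : R, forall p, `|hinge_speed p| <= K.
Proof.
pose m := Num.min Cpar Cperp.
have m0 : 0 < m by rewrite lt_min Cpar0.
exists (Cperp * L / (4 * m)) => p; rewrite /hinge_speed.
have A0 := drag_bisector_gt0 Cpar0 Cperp0 p.
set A := Cpar * _ + _ in A0 *.
have mA : m <= A.
  have h1 : m <= Cpar by rewrite ge_min lexx.
  have h2 : m <= Cperp by rewrite ge_min lexx orbT.
  have -> : m = m * cos (p / 2) ^+ 2 + m * sin (p / 2) ^+ 2.
    by rewrite -mulrDr cos2Dsin2 mulr1.
  by apply: lerD; rewrite ler_wpM2r // sqr_ge0.
rewrite !normrM normfV (gtr0_norm (x := 4 * A)) ?mulr_gt0 //.
rewrite (gtr0_norm Cperp0) (gtr0_norm L0).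
have CL := mulr_gt0 Cperp0 L0.
apply: ler_pM.
- by rewrite mulr_ge0 ?(ltW CL).
- by rewrite invr_ge0 mulr_ge0 ?(ltW A0).
- by rewrite ler_piMr ?(ltW CL) ?sin_max.
- by rewrite lef_pV2 ?posrE ?mulr_gt0 // ler_pM2l.
Qed.

Lemma lip_on_hinge (p q a b : R) : lip_on p q (fun x => d (a + x * b)).
Proof. by have [K HK] := hinge_speed_bounded; exact: lip_on_affine dE HK. Qed.

Lemma half_affine (a b x : R) : (a + x * b) / 2 = a / 2 + x * (b / 2).
Proof. by rewrite mulrDl mulrA. Qed.

Lemma is_derive_cos_half (a b t : R) :
  is_derive t 1 (fun x => cos ((a + x * b) / 2)) (b * (- (1 / 2 * sin ((a + t * b) / 2)))).
Proof.
under eq_fun do rewrite half_affine.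
apply: (@is_derive_eq _ _ _ _ _ _ _ _ (is_derive_affine (is_derive_cos _))).
by rewrite half_affine; ring.
Qed.

Lemma is_derive_sin_half (a b t : R) :
  is_derive t 1 (fun x => sin ((a + x * b) / 2)) (b * (1 / 2 * cos ((a + t * b) / 2))).
Proof.
under eq_fun do rewrite half_affine.
apply: (@is_derive_eq _ _ _ _ _ _ _ _ (is_derive_affine (is_derive_sin _))).
by rewrite half_affine; ring.
Qed.

(** [bis] itself solves the equation of a pure bending, and so does [k *m bis] for every constant
    [k]: bending leaves the frame of the bisector fixed. *)
Lemma is_derive_bis (a b t : R) :
  is_derive t 1 (fun x => bis (a + x * b)) (bis (a + t * b) *m (b *: hat1 (a + t * b))).
Proof.
apply: (@is_derive_eq _ _ _ _ _ _ _ _ (is_derive_ymat (is_derive_cos_half a b t) (is_derive_sin_half a b t)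
  (is_derive_affine (dE (a + t * b))))).
rewrite hat1E.
have ec := cos2sin2 ((a + t * b) / 2).
by apply/matrixP => -[[|[|[|[|//]]]] ?] -[[|[|[|[|//]]]] ?];
  rewrite !mxE ?big_ord_recr ?big_ord0 /= ?mxE /=; ring: ec.
Qed.

Lemma is_derive_bis_inv (a b t : R) :
  is_derive t 1 (fun x => bis_inv (a + x * b))
    (- ((b *: hat1 (a + t * b)) *m bis_inv (a + t * b))).
Proof.
apply: (@is_derive_eq _ _ _ _ _ _ _ _ (is_derive_ymat_inv (is_derive_cos_half a b t) (is_derive_sin_half a b t)
  (is_derive_affine (dE (a + t * b))))).
rewrite hat1E.
by apply/matrixP => -[[|[|[|[|//]]]] ?] -[[|[|[|[|//]]]] ?];
  rewrite !mxE ?big_ord_recr ?big_ord0 /= ?mxE /=; ring.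
Qed.

Lemma lip_on_cos_half (p q a b : R) : lip_on p q (fun x => cos ((a + x * b) / 2)).
Proof. by under eq_fun do rewrite half_affine; exact: lip_on_cos_affine. Qed.

Lemma lip_on_sin_half (p q a b : R) : lip_on p q (fun x => sin ((a + x * b) / 2)).
Proof. by under eq_fun do rewrite half_affine; exact: lip_on_sin_affine. Qed.

Lemma reach_bend (k : 'M[R]_4) (th p q : R) : in_SE3 k ->
  reach (k *m bis p *m rotz (- th)) th p (k *m bis q *m rotz (- th)) th q.
Proof.
move=> Sk; have [ki _ [kki kik]] := in_SE3_inv Sk.
have := @reach_frame (q - p) 0 th p (fun t => k *m bis (p + t * (q - p)))
  (fun t => bis_inv (p + t * (q - p)) *m ki) (fun t => (q - p) *: hat1 (p + t * (q - p))).
rewrite mul0r mul1r !addr0 subrKC; apply.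
- by move=> t; rewrite -mulmxA; apply: is_derive_mulmxl; exact: is_derive_bis.
- by move=> t; rewrite mulmxA -mulNmx; apply: is_derive_mulmxr; exact: is_derive_bis_inv.
- apply: mlip_on_mul; first exact: mlip_on_cst.
  by apply: mlip_ymat; [exact: lip_on_cos_half | exact: lip_on_sin_half | exact: lip_on_hinge].
- apply: mlip_on_mul; last exact: mlip_on_cst.
  by apply: mlip_ymat_inv; [exact: lip_on_cos_half | exact: lip_on_sin_half | exact: lip_on_hinge].
- by move=> t; apply: in_SE3M => //; apply: in_SE3_ymat; exact: bis_unit.
- by move=> t; rewrite -mulmxA (mulmxA (bis _)) ymatK ?bis_unit // mul1mx.
- by move=> t; rewrite scale0r addr0.
Qed.

Definition spin_rate (p : R) := tilt_rate p * axis_norm p.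

Lemma spin_rate_gt0 (p : R) : 0 < spin_rate p.
Proof.
by rewrite mulr_gt0 ?axis_norm_gt0 // divr_gt0 ?tilt_den_gt0 // mulr_gt0.
Qed.

(** Seen from the frame of the bisector, the velocity of a spin is the generator of the rotations
    about the z-axis of [axis_frame p]. Placing [bis p] on both sides avoids its inverse. *)
Lemma axis_frame_bis (p : R) :
  spin_rate p *: (axis_frame p *m ez_hat R *m axis_frame_inv p) *m bis p =
  bis p *m (hat2 p + ez_hat R).
Proof.
rewrite ymat_ez_hat ?axis_unit // hat2E se3_of_colseq.
have r0 := lt0r_neq0 (axis_norm_gt0 p).
(* The factor [spin_rate] cancels the square root [axis_norm]; only polynomials in the sine and
   cosine remain. *)
have ks : spin_rate p * axis_sin p = tilt_rate p * (4 * sin (p / 2) ^+ 3).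
  by rewrite /spin_rate /axis_sin; field.
have kc : spin_rate p * axis_cos p = tilt_rate p * cos (p / 2) ^+ 3.
  by rewrite /spin_rate /axis_cos; field.
have -> : spin_rate p *: mxseq 4 4
    [:: [:: 0; - axis_cos p; 0; 0];
        [:: axis_cos p; 0; - - axis_sin p; - (axis_sin p * axis_height p)];
        [:: - 0; - axis_sin p; 0; 0]; [:: 0; 0; 0; 0]] =
  mxseq 4 4
    [:: [:: 0; - (tilt_rate p * cos (p / 2) ^+ 3); 0; 0];
        [:: tilt_rate p * cos (p / 2) ^+ 3; 0; tilt_rate p * (4 * sin (p / 2) ^+ 3);
            - (tilt_rate p * (4 * sin (p / 2) ^+ 3) * axis_height p)];
        [:: 0; - (tilt_rate p * (4 * sin (p / 2) ^+ 3)); 0; 0]; [:: 0; 0; 0; 0]].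
  by rewrite -ks -kc; apply/matrixP => -[[|[|[|[|//]]]] ?] -[[|[|[|[|//]]]] ?];
    rewrite !mxE /=; ring.
have ec := cos2sin2 (p / 2); rewrite /axis_height /bis.
move: ec; move: (sin (p / 2)) (cos (p / 2)) (tilt_rate p) (d p) => s c k z ec.
by apply/matrixP => -[[|[|[|[|//]]]] ?] -[[|[|[|[|//]]]] ?];
  rewrite !mxE ?big_ord_recr ?big_ord0 /= ?mxE /=; field: ec.
Qed.

(** At fixed [ph] the generator of [axis_frame_bis] is constant, so the motion integrates to a
    one-parameter group of rotations about a fixed axis. *)
Lemma reach_spin (k : 'M[R]_4) (th p t : R) : in_SE3 k ->
  reach (k *m bis p *m rotz (- th)) th p
    (k *m (axis_frame p *m rotz (spin_rate p * t) *m axis_frame_inv p) *m bis p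
       *m rotz (- (th + t))) (th + t) p.
Proof.
move=> Sk; have [ki _ [kki kik]] := in_SE3_inv Sk.
pose F := axis_frame p; pose Fi := axis_frame_inv p; pose r := spin_rate p * t.
pose B := bis p; pose Bi := bis_inv p.
have FFi : F *m Fi = 1%:M by rewrite ymatK ?axis_unit.
have FiF : Fi *m F = 1%:M by exact: mulmx1C.
have BBi : B *m Bi = 1%:M by rewrite ymatK ?bis_unit.
have BiB : Bi *m B = 1%:M by exact: mulmx1C.
have key : t *: (hat2 p + ez_hat R) = Bi *m F *m (r *: ez_hat R) *m Fi *m B.
  rewrite -[LHS]mul1mx -BiB -!mulmxA -scalemxAr -axis_frame_bis -/F -/Fi -/B.
  by rewrite -!scalemxAl -!scalemxAr !mulmxA scalerA mulrC.
have := @reach_frame 0 t th p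
  (fun x => k *m F *m rotz (0 + x * r) *m (Fi *m B))
  (fun x => Bi *m F *m rotz (- (0 + x * r)) *m (Fi *m ki))
  (fun=> t *: (hat2 p + ez_hat R)).
rewrite mul0r mul1r !add0r addr0 rotz0 mulmx1.
have -> : k *m F *m (Fi *m B) = k *m B by rewrite mulmxA -(mulmxA k) FFi mulmx1.
rewrite !mulmxA; apply.
- move=> x; apply: (@is_derive_eq _ _ _ _ _ _ _ _
    (is_derive_mulmxr (Fi *m B) (is_derive_mulmxl (k *m F) (is_derive_rotz 0 r x)))).
  rewrite key !mulmxA -(mulmxA _ B Bi) BBi mulmx1 -(mulmxA _ Fi F) FiF mulmx1.
  by rewrite -!scalemxAr !mulmxA.
- move=> x; apply: (@is_derive_eq _ _ _ _ _ _ _ _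
    (is_derive_mulmxr (Fi *m ki) (is_derive_mulmxl (Bi *m F) (is_derive_rotzN 0 r x)))).
  rewrite key !mulmxA -(mulmxA _ B Bi) BBi mulmx1 -(mulmxA _ Fi F) FiF mulmx1.
  by rewrite rotz_ez_hat scalemxAl scaleNr mulNmx mulmxN !mulNmx !mulmxA.
- apply: mlip_on_mul; last exact: mlip_on_cst.
  by apply: mlip_on_mul; [exact: mlip_on_cst | exact: mlip_rotz].
- apply: mlip_on_mul; last exact: mlip_on_cst.
  by apply: mlip_on_mul; [exact: mlip_on_cst | exact: mlip_rotzN].
- have SF : in_SE3 F by apply: in_SE3_ymat; exact: axis_unit.
  have SB : in_SE3 B by apply: in_SE3_ymat; exact: bis_unit.
  have [G SG [FG _]] := in_SE3_inv SF.
  have FiG : Fi = G by rewrite -[Fi]mulmx1 -FG mulmxA FiF mul1mx.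
  move=> x; rewrite FiG; apply: in_SE3M; last exact: in_SE3M.
  by apply: in_SE3M; [exact: in_SE3M | exact: in_SE3_rotz].
- move=> x; rewrite !mulmxA -(mulmxA _ B Bi) BBi mulmx1 -(mulmxA _ Fi F) FiF mulmx1.
  by rewrite -(mulmxA _ (rotz _) (rotz _)) rotzKN mulmx1 -(mulmxA k) FFi mulmx1.
- by move=> x; rewrite scale0r add0r mulr0 addr0.
Qed.

End Moves.

(** * Generation of SE(3) *)

Section Generation.
Variable R : realType.
Implicit Types (Q : 'M[R]_3) (v : 'cV[R]_3).

Lemma unit_circle_angle (x y : R) : x ^+ 2 + y ^+ 2 = 1 ->
  exists t, x = cos t /\ y = sin t.
Proof.
move=> xy; have x2 : x ^+ 2 <= 1 by rewrite -xy lerDl sqr_ge0.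
have x1 : -1 <= x by nra.
have x1' : x <= 1 by nra.
have s : Num.sqrt (1 - x ^+ 2) = `|y| by rewrite -xy addrAC subrr add0r sqrtr_sqr.
have xI : x \in `[(-1), 1] by rewrite in_itv /= x1.
have [y0|y0] := leP 0 y.
  by exists (acos x); rewrite acosK // sin_acos ?x1 // s ger0_norm.
by exists (- acos x); rewrite cosN sinN acosK // sin_acos ?x1 // s ltr0_norm // opprK.
Qed.

Lemma polar_angle (x y : R) : exists r t, x = r * cos t /\ y = r * sin t.
Proof.
have [xy0|xy0] := eqVneq (x ^+ 2 + y ^+ 2) 0.
  exists 0, 0; rewrite !mul0r; move/eqP: xy0.
  by rewrite paddr_eq0 ?sqr_ge0 // !sqrf_eq0 => /andP[/eqP -> /eqP ->].
have xy : 0 < x ^+ 2 + y ^+ 2 by rewrite lt_neqAle eq_sym xy0 addr_ge0 ?sqr_ge0.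
pose r := Num.sqrt (x ^+ 2 + y ^+ 2).
have r0 : r != 0 by rewrite gt_eqF // sqrtr_gt0.
have [|t [xt yt]] := @unit_circle_angle (x / r) (y / r).
  by rewrite !expr_div_n -mulrDl sqr_sqrtr ?(ltW xy) // divff.
by exists r, t; rewrite -xt -yt ![r * _]mulrC !divfK.
Qed.

Lemma matrix3_eta Q : Q = mxseq 3 3 [:: [:: Q 0 0; Q 0 1; Q 0 2]; [:: Q 1 0; Q 1 1; Q 1 2];
  [:: Q 2 0; Q 2 1; Q 2 2]].
Proof.
by apply/matrixP => -[[|[|[|//]]] ?] -[[|[|[|//]]] ?]; rewrite mxE /=;
  congr (Q _ _); apply: val_inj.
Qed.

(** The third row is a unit vector with last entry 1, so its other entries vanish; in the remaining
    block, orthogonality and determinant 1 force the second column from the first. *)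
Lemma SO3_fix_ez Q : in_SO3 Q -> Q 0 2 = 0 -> Q 1 2 = 0 -> Q 2 2 = 1 ->
  exists t, Q = rz (cos t) (sin t).
Proof.
move=> SQ q02 q12 q22; have QQt := in_SO3_trr SQ; have [QtQ dQ] := SQ.
have h22 := congr1 (fun M : 'M[R]_3 => M 2 2) QQt.
have h00 := congr1 (fun M : 'M[R]_3 => M 0 0) QtQ.
have h01 := congr1 (fun M : 'M[R]_3 => M 0 1) QtQ.
move: dQ; rewrite {1}(matrix3_eta Q) det_mxseq3 q02 q12 q22 => dQ.
move: h22 h00 h01; rewrite !mxE !big_ord_recr !big_ord0 /= !mxE /=.
have -> : widen_ord (leqnSn 2) (widen_ord (leqnSn 1) ord_max) = 0 :> 'I_3 by apply: val_inj.
have -> : widen_ord (leqnSn 2) ord_max = 1 :> 'I_3 by apply: val_inj.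
have -> : ord_max = 2 :> 'I_3 by apply: val_inj.
rewrite q22 => h22 h00 h01.
have /eqP : Q 2 0 ^+ 2 + Q 2 1 ^+ 2 = 0 by move: h22; rewrite -!expr2; lra.
rewrite paddr_eq0 ?sqr_ge0 // !sqrf_eq0 => /andP[/eqP q20 /eqP q21].
move: h00 h01 dQ; rewrite q20 q21 => h00 h01 dQ.
have [|t [ct st]] := @unit_circle_angle (Q 0 0) (Q 1 0).
  by rewrite !expr2; lra.
exists t; rewrite (matrix3_eta Q) q02 q12 q22 q20 q21 -ct -st.
have q01 : Q 0 1 = - Q 1 0.
  move: h00 h01 dQ; move: (Q 0 0) (Q 1 0) (Q 0 1) (Q 1 1) => a c b e h00 h01 dQ.
  apply/eqP; rewrite -subr_eq0 opprK.
  (* An explicit combination of the unit length of the first column, its orthogonality to the second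
     and the value of the determinant. *)
  have -> : b + c = b * (1 - (0 + a * a + c * c + 0 * 0)) + a * (0 + a * b + c * e + 0 * 0)
    + c * (1 - (a * (e * 1 - 0 * 0) - b * (c * 1 - 0 * 0) + 0 * (c * 0 - e * 0))) by ring.
  by rewrite h00 h01 dQ subrr !mulr0 !addr0.
have q11 : Q 1 1 = Q 0 0.
  move: h00 h01 dQ; move: (Q 0 0) (Q 1 0) (Q 0 1) (Q 1 1) => a c b e h00 h01 dQ.
  apply/eqP; rewrite -subr_eq0.
  have -> : e - a = e * (1 - (0 + a * a + c * c + 0 * 0)) + c * (0 + a * b + c * e + 0 * 0)
    - a * (1 - (a * (e * 1 - 0 * 0) - b * (c * 1 - 0 * 0) + 0 * (c * 0 - e * 0))) by ring.
  by rewrite h00 h01 dQ subrr !mulr0 addr0 subr0.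
by rewrite q01 q11.
Qed.

Lemma rz_so3 (t : R) : in_SO3 (rz (cos t) (sin t)).
Proof. exact/in_SO3_z/cos2Dsin2. Qed.

Lemma ry_so3 (t : R) : in_SO3 (ry (cos t) (sin t)).
Proof. exact/in_SO3_y/cos2Dsin2. Qed.

(** A turn about z brings the third column into the xz-plane, a turn about y brings it to the
    z-axis, and what is left fixes that axis. *)
Lemma euler_angles Q : in_SO3 Q -> exists x y z,
  Q = rz (cos x) (sin x) *m ry (cos y) (sin y) *m rz (cos z) (sin z).
Proof.
move=> SQ; have [r [t [xt yt]]] := polar_angle (Q 0 2) (Q 1 2).
have n1 : r ^+ 2 + Q 2 2 ^+ 2 = 1.
  have [QtQ _] := SQ; have := congr1 (fun M : 'M[R]_3 => M 2 2) QtQ.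
  rewrite !mxE !big_ord_recr !big_ord0 /= !mxE /=.
  have -> : widen_ord (leqnSn 2) (widen_ord (leqnSn 1) ord_max) = 0 :> 'I_3 by apply: val_inj.
  have -> : widen_ord (leqnSn 2) ord_max = 1 :> 'I_3 by apply: val_inj.
  have -> : ord_max = 2 :> 'I_3 by apply: val_inj.
  rewrite xt yt => h; apply: etrans h; have ct := cos2sin2 t; by ring: ct.
have [|y [zy ry_]] := @unit_circle_angle (Q 2 2) r; first by rewrite addrC.
pose M := ry (cos y) (sin y) *m rz (cos (- t)) (sin (- t)) *m Q.
have SM : in_SO3 M by apply: in_SO3M => //; apply: in_SO3M; [exact: ry_so3 | exact: rz_so3].
have col3 i : M i 2 = (ry (cos y) (sin y) *m (rz (cos (- t)) (sin (- t)) *m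
    colseq 3 [:: r * cos t; r * sin t; cos y])) i 0.
  rewrite /M -mulmxA !mxE; apply: eq_bigr => j _; congr (_ * _).
  rewrite !mxE; apply: eq_bigr => k _; congr (_ * _); rewrite mxE -xt -yt -zy.
  by case: k => [[|[|[|//]]] ?] /=; congr (Q _ _); apply: val_inj.
have ct := cos2sin2 t; have cy := cos2sin2 y.
have [z Mz] : exists z, M = rz (cos z) (sin z).
  apply: SO3_fix_ez => //; rewrite col3 !mxE !big_ord_recr !big_ord0 /= !mxE /=
    !big_ord_recr !big_ord0 /= !mxE /= ?cosN ?sinN ry_; by ring: ct cy.
exists t, (- y), z; rewrite -Mz /M.
have K1 : rz (cos t) (sin t) *m rz (cos (- t)) (sin (- t)) = 1%:M.
  apply/matrixP => -[[|[|[|//]]] ?] -[[|[|[|//]]] ?];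
  by rewrite !mxE !big_ord_recr !big_ord0 /= !mxE /= ?cosN ?sinN; ring: ct.
have K2 : ry (cos (- y)) (sin (- y)) *m ry (cos y) (sin y) = 1%:M.
  apply/matrixP => -[[|[|[|//]]] ?] -[[|[|[|//]]] ?];
  by rewrite !mxE !big_ord_recr !big_ord0 /= !mxE /= ?cosN ?sinN; ring: cy.
rewrite !mulmxA -(mulmxA (rz _ _) (ry _ _) (ry _ _)) K2 mulmx1.
by rewrite K1 mul1mx.
Qed.

Definition transl v : 'M[R]_4 := se 1%:M v.

Lemma translD v w : transl v *m transl w = transl (w + v).
Proof. by rewrite /transl se_mul !mul1mx. Qed.

Lemma transl_conj Q v : in_SO3 Q -> se Q 0 *m transl v *m se Q^T 0 = transl (Q *m v).
Proof. by move=> SQ; rewrite /transl !se_mul mulmx0 addr0 add0r mulmx1 in_SO3_trr. Qed.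

Definition xvec (x : R) : 'cV[R]_3 := colseq 3 [:: x; 0; 0].
Definition zvec (x : R) : 'cV[R]_3 := colseq 3 [:: 0; 0; x].

(* The sum of two horizontal vectors of length [`|r|] symmetric about the x-axis is
   any vector of length at most [2 `|r|] on that axis. *)
Lemma transl_line (H : 'M[R]_4 -> Prop) (r : R) :
  (forall g h, H g -> H h -> H (g *m h)) ->
  (forall Q, in_SO3 Q -> H (se Q 0)) -> r != 0 -> H (transl (xvec r)) ->
  forall x, H (transl (xvec x)).
Proof.
move=> HM HQ r0 Hr.
have Hc v Q : in_SO3 Q -> H (transl v) -> H (transl (Q *m v)).
  move=> SQ Hv; rewrite -transl_conj //; apply: (HM); last exact/HQ/in_SO3T.
  by apply: (HM) => //; exact: HQ.
have short x : `|x| <= `|2 * r| -> H (transl (xvec x)).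
  move=> xr; have r2 : 0 < `|2 * r| by rewrite normr_gt0 mulf_neq0.
  have c1 : -1 <= x / (2 * r) <= 1 by rewrite -ler_norml normrM normfV ler_pdivrMr // mul1r.
  have cE : cos (acos (x / (2 * r))) = x / (2 * r) by rewrite acosK // in_itv.
  have -> : xvec x = rz (cos (acos (x / (2 * r)))) (sin (acos (x / (2 * r)))) *m xvec r +
      rz (cos (- acos (x / (2 * r)))) (sin (- acos (x / (2 * r)))) *m xvec r.
    apply/colP => -[[|[|[|//]]] ?];
    rewrite !mxE !big_ord_recr !big_ord0 /= !mxE /= ?cosN ?sinN ?cE; first by field.
      by ring.
    by ring.
  by rewrite -translD; apply: (HM); apply: (Hc) => //; exact: rz_so3.
(* A long translation is cut into [n.+1] equal ones, each of length at most [|2 * r|]; the successor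
   keeps the divisor nonzero. *)
move=> x; pose n := Num.bound `|x / (2 * r)|.
have n1 : 0 < n.+1%:R :> R by rewrite ltr0n.
have sx : H (transl (xvec (x / n.+1%:R))).
  apply: short; rewrite normrM normfV (gtr0_norm n1) ler_pdivrMr //.
  have r2 : 0 < `|2 * r| by rewrite normr_gt0 mulf_neq0.
  have := archi_boundP (normr_ge0 (x / (2 * r))); rewrite -/n.
  rewrite normrM normfV ltr_pdivrMr // mulrC => /ltW /le_trans; apply.
  by rewrite ler_wpM2l // ler_nat.
have mult k : H (transl (xvec (x / n.+1%:R *+ k.+1))).
  elim: k => [|k IH]; first by rewrite mulr1n.
  have -> : xvec (x / n.+1%:R *+ k.+2) = xvec (x / n.+1%:R) + xvec (x / n.+1%:R *+ k.+1).
    by apply/colP => -[[|[|[|//]]] ?]; rewrite !mxE /= ?addr0 // mulrS.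
  by rewrite -translD; exact: HM.
by have := mult n; rewrite -mulr_natr divfK // gt_eqF.
Qed.

Implicit Types (H : 'M[R]_4 -> Prop).

Lemma ymat_invE (a b z : R) :
  ymat_inv a b z = se (ry a b)^T (- ((ry a b)^T *m zvec z)).
Proof.
apply: se_eqP; [move=> -[[|[|[|//]]] ?] -[[|[|[|//]]] ?]
  |move=> -[[|[|[|//]]] ?] |move=> -[[|[|[|//]]] ?] | ];
  rewrite !mxE ?big_ord_recr ?big_ord0 /= ?mxE /=; by [|ring].
Qed.

(** The second family consists of the rotations about the x-axis; a quarter-turn about z conjugates
    them to those about y, and Euler angles conclude. *)
Lemma SO3_generated H :
  (forall g h, H g -> H h -> H (g *m h)) ->
  (forall t, H (rotz t)) ->
  (forall t, H (ymat 0 1 0 *m rotz t *m ymat_inv 0 1 0)) ->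
  forall Q, in_SO3 Q -> H (se Q 0).
Proof.
move=> HM Hz Hx.
have Hrz t : H (se (rz (cos t) (sin t)) 0) by rewrite -zmatE; exact: Hz.
have Hry t : H (se (ry (cos t) (sin t)) 0).
  have -> : se (ry (cos t) (sin t)) 0 = rotz (pi / 2) *m
      (ymat 0 1 0 *m rotz t *m ymat_inv 0 1 0) *m rotz (- (pi / 2)).
    pose X : 'M[R]_4 := mxseq 4 4 [:: [:: 1; 0; 0; 0]; [:: 0; cos t; sin t; 0];
      [:: 0; - sin t; cos t; 0]; [:: 0; 0; 0; 1]].
    have -> : ymat 0 1 0 *m rotz t = X *m ymat 0 1 0.
      by apply/matrixP => -[[|[|[|[|//]]]] ?] -[[|[|[|[|//]]]] ?];
        rewrite !mxE ?big_ord_recr ?big_ord0 /= ?mxE /=; ring.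
    rewrite -(mulmxA X) ymatK ?mulmx1; last by rewrite expr0n expr1n add0r.
    have -> : rotz (pi / 2) *m X = ymat (cos t) (sin t) 0 *m rotz (pi / 2).
      by apply/matrixP => -[[|[|[|[|//]]]] ?] -[[|[|[|[|//]]]] ?];
        rewrite !mxE ?big_ord_recr ?big_ord0 /= ?mxE /= ?cos_pihalf ?sin_pihalf; ring.
    rewrite -mulmxA rotzKN mulmx1 ymatE; congr se.
    by apply/colP => -[[|[|[|//]]] ?]; rewrite !mxE.
  by apply: (HM) => //; apply: (HM).
move=> Q /euler_angles[x [y [z ->]]].
have -> : se (rz (cos x) (sin x) *m ry (cos y) (sin y) *m rz (cos z) (sin z)) 0 =
  se (rz (cos x) (sin x)) 0 *m se (ry (cos y) (sin y)) 0 *m se (rz (cos z) (sin z)) 0.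
  by rewrite !se_mul !mulmx0 !addr0.
by apply: (HM) => //; apply: (HM).
Qed.

(* The third family contributes a horizontal translation, obtained from its
   half-turn composed with the one about the z-axis. *)
Lemma SE3_generated0 H (a b m : R) : a ^+ 2 + b ^+ 2 = 1 -> b != 0 -> m != 0 ->
  (forall g h, H g -> H h -> H (g *m h)) ->
  (forall t, H (rotz t)) ->
  (forall t, H (ymat 0 1 0 *m rotz t *m ymat_inv 0 1 0)) ->
  (forall t, H (ymat a b m *m rotz t *m ymat_inv a b m)) ->
  forall g, in_SE3 g -> H g.
Proof.
move=> ab b0 m0 HM Hz Hx Hy.
have HQ := SO3_generated HM Hz Hx.
have SA : in_SO3 (ry a b) by exact: in_SO3_y.
have Hex : forall x, H (transl (xvec x)).
  apply: (@transl_line H (2 * b * m)) => //; first by rewrite !mulf_neq0.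
  pose Z := rz (cos pi) (sin pi) : 'M[R]_3; pose A := ry a b.
  (* Conjugation by [A] makes the axis of the half-turn vertical, at horizontal distance [b * m]
     from the z-axis; two half-turns about parallel lines compose to a translation by twice their
     offset. *)
  have -> : transl (xvec (2 * b * m)) =
      se A^T 0 *m (ymat a b m *m rotz pi *m ymat_inv a b m) *m se A 0 *m rotz (- pi).
    rewrite /rotz !zmatE ymatE ymat_invE !se_mul /transl -/A.
    have e : a ^+ 2 = 1 - b ^+ 2 by rewrite -ab addrK.
    rewrite -/Z.
    have AA : A^T *m A = 1%:M by case: SA.
    have ZZ : Z *m rz (cos (- pi)) (sin (- pi)) = 1%:M.
      apply/matrixP => -[[|[|[|//]]] ?] -[[|[|[|//]]] ?];
      by rewrite !mxE !big_ord_recr !big_ord0 /= !mxE /= ?cosN ?sinN ?cospi ?sinpi; ring.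
    congr se.
      by rewrite !mulmxA AA mul1mx -(mulmxA _ _ A) AA mulmx1 ZZ.
    rewrite !mulmx0 !addr0 !add0r -/(zvec m) !mulmxDr !mulmxN !mulmxA AA mul1mx.
    have w : A^T *m zvec m = colseq 3 [:: b * m; 0; a * m].
      by apply/colP => -[[|[|[|//]]] ?]; rewrite !mxE !big_ord_recr big_ord0 /= !mxE /=; ring.
    rewrite -(mulmxA Z) w; apply/colP => -[[|[|[|//]]] ?];
    by rewrite !mxE !big_ord_recr big_ord0 /= !mxE /= ?cospi ?sinpi; ring.
  apply: (HM) => //; apply: (HM); last exact: HQ.
  by apply: (HM) => //; exact/HQ/in_SO3T.
have Hconj v Q : in_SO3 Q -> H (transl v) -> H (transl (Q *m v)).
  move=> SQ Hv; rewrite -transl_conj //; apply: (HM); last exact/HQ/in_SO3T.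
  by apply: (HM) => //; exact: HQ.
move=> g [Q [x [SQ ->]]]; rewrite -/(se Q x).
have -> : se Q x = transl x *m se Q 0 by rewrite /transl se_mul mul1mx mulmx0 add0r.
apply: (HM); last exact: HQ.
(* Quarter-turns carry the x-axis to the y-axis and to the z-axis. *)
have -> : x = xvec (x 0 0) + (rz 0 1 *m xvec (x 1 0) + ry 0 1 *m xvec (x 2 0)).
  apply/colP => -[[|[|[|//]]] ?]; rewrite !mxE !big_ord_recr !big_ord0 /= !mxE /=;
  by rewrite ?mul0r ?mul1r ?oppr0 ?mul0r ?mulr0 ?addr0 ?add0r; congr (x _ _); apply: val_inj.
have u01 : 0 ^+ 2 + 1 ^+ 2 = 1 :> R by rewrite expr0n expr1n add0r.
rewrite addrC -translD; apply: (HM); first exact: Hex.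
by rewrite -translD; apply: (HM); apply: (Hconj) => //; [exact: in_SO3_y | exact: in_SO3_z].
Qed.

(** Conjugation by the translation [T] along the z-axis moves the origin to height [m1]; it commutes
    with [rotz] and lowers the other two axes to heights 0 and [m2 - m1]. *)
Lemma SE3_generated H (a b m1 m2 : R) : a ^+ 2 + b ^+ 2 = 1 -> b != 0 -> m1 != m2 ->
  (forall g h, H g -> H h -> H (g *m h)) ->
  (forall t, H (rotz t)) ->
  (forall t, H (ymat 0 1 m1 *m rotz t *m ymat_inv 0 1 m1)) ->
  (forall t, H (ymat a b m2 *m rotz t *m ymat_inv a b m2)) ->
  forall g, in_SE3 g -> H g.
Proof.
move=> ab b0 m12 HM Hz Hx Hy g Sg.
pose T := transl (zvec m1); pose Ti := transl (zvec (- m1)).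
have zvecD x y : zvec x + zvec y = zvec (x + y) :> 'cV[R]_3.
  by apply/colP => -[[|[|[|//]]] ?]; rewrite !mxE /= ?addr0.
have zvec0 : zvec 0 = 0 :> 'cV[R]_3.
  by apply/colP => -[[|[|[|//]]] ?]; rewrite !mxE.
have TTi : T *m Ti = 1%:M by rewrite translD zvecD addNr zvec0 /transl se1.
have TiT : Ti *m T = 1%:M by exact: mulmx1C.
have yT (c d z : R) : T *m ymat c d z = ymat c d (m1 + z).
  rewrite !ymatE /T /transl se_mul !mul1mx -/(zvec z) -/(zvec (m1 + z)) -zvecD.
  by rewrite addrC.
have yiT (c d z : R) : c ^+ 2 + d ^+ 2 = 1 -> ymat_inv c d z *m Ti = ymat_inv c d (m1 + z).
  move=> cd; rewrite -[LHS]mulmx1 -(ymatK (m1 + z) cd) -yT !mulmxA.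
  by rewrite -(mulmxA _ Ti T) TiT mulmx1 ymat_invK // mul1mx.
have u01 : 0 ^+ 2 + 1 ^+ 2 = 1 :> R by rewrite expr0n expr1n add0r.
suff : H (T *m (Ti *m g *m T) *m Ti).
  by rewrite !mulmxA TTi mul1mx -mulmxA TTi mulmx1.
apply: (@SE3_generated0 (fun h => H (T *m h *m Ti)) a b (m2 - m1) ab b0).
- by rewrite subr_eq0 eq_sym.
- move=> h h' Hh Hh'; have := HM _ _ Hh Hh'.
  by rewrite !mulmxA -(mulmxA _ Ti T) TiT mulmx1.
- move=> t; suff -> : T *m rotz t *m Ti = rotz t by [].
  have Tz : T *m rotz t = rotz t *m T.
    rewrite /rotz !zmatE /T /transl !se_mul !mul1mx mulmx1 addr0 add0r; congr se.
    by apply/colP => -[[|[|[|//]]] ?]; rewrite !mxE !big_ord_recr !big_ord0 /= !mxE /=; ring.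
  by rewrite Tz -mulmxA TTi mulmx1.
- move=> t; rewrite -!mulmxA yiT // !mulmxA yT addr0; exact: Hx.
- move=> t; rewrite -!mulmxA yiT // !mulmxA yT subrKC; exact: Hy.
- by apply: in_SE3M; [apply: in_SE3M => // |]; apply: in_SE3_se; split;
    rewrite ?trmx1 ?mul1mx ?det1.
Qed.

End Generation.

(** * Controllability *)

Section Controllability.
Variable R : realType.
Variables Cpar Cperp Ctau L : R.
Hypotheses (Cpar0 : 0 < Cpar) (Cperp0 : 0 < Cperp) (Ctau0 : 0 < Ctau) (L0 : 0 < L).
Hypothesis aniso : Cpar != Cperp.
Local Notation hinge_speed := (hinge_speed Cpar Cperp L).
Local Notation tilt_rate := (tilt_rate Cperp Ctau L).

Lemma is_derive_half_cos (x : R) :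
  is_derive x 1 (fun y => cos (y / 2)) (- (1 / 2 * sin (x / 2))).
Proof.
have E (y : R) : (0 + y * 1) / 2 = y / 2 by rewrite add0r mulr1.
have := is_derive_cos_half 0 1 x.
by under eq_fun do rewrite E; rewrite E mul1r.
Qed.

(** In the variable [c = cos (x / 2)] the integrand is [- (L / 2) / (1 + q c^2)] with
    [q = (Cpar - Cperp) / Cperp]: a difference of logarithms for negative [q], an arctangent for
    positive [q]. *)
Lemma hinge_antiderivative :
  exists d : R -> R, forall x : R, is_derive x 1 d (hinge_speed x).
Proof.
have den (x : R) : Cpar * cos (x / 2) ^+ 2 + Cperp * sin (x / 2) ^+ 2 =
    Cperp * (1 + (Cpar - Cperp) / Cperp * cos (x / 2) ^+ 2).
  by rewrite sin2cos2; field; exact: lt0r_neq0.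
have C0 := lt0r_neq0 Cperp0.
case: (ltgtP Cpar Cperp) aniso => // [lt|gt] _.
- pose al : R := Num.sqrt ((Cperp - Cpar) / Cperp).
  have q0 : 0 < (Cperp - Cpar) / Cperp by rewrite divr_gt0 // subr_gt0.
  have al0 : 0 < al by rewrite sqrtr_gt0.
  have al2 : al ^+ 2 = (Cperp - Cpar) / Cperp by rewrite sqr_sqrtr // ltW.
  (* By [Cpar > 0]; this keeps the arguments of both logarithms positive. *)
  have al1 : al < 1.
    by rewrite -(@expr_lt1 _ 2) ?(ltW al0) // al2 ltr_pdivrMr // mul1r gtrBl.
  have pos (y : R) : `|y| <= 1 -> 0 < 1 + al * y.
    rewrite ler_norml => /andP[y1 y2].
    have y3 : 0 <= y + 1 by lra.
    have := mulr_ge0 (ltW al0) y3; lra.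
  exists (fun x => - (L / (4 * al)) *
    (ln (1 + al * cos (x / 2)) - ln (1 + al * - cos (x / 2)))) => x.
  have h1 := pos _ (cos_max (x / 2)).
  have h2 : 0 < 1 + al * - cos (x / 2) by apply: pos; rewrite normrN cos_max.
  have dc := is_derive_half_cos x.
  have dln (b db : R) (f : R -> R) : is_derive x 1 f db -> 0 < 1 + al * f x ->
      is_derive x 1 (fun y => ln (1 + al * f y)) ((1 + al * f x)^-1 * (al * db)).
    move=> df fx; have dg : is_derive x 1 (fun y => 1 + al * f y) (al * db).
      apply: (@is_derive_eq _ _ _ _ _ _ _ _ (is_deriveD (is_derive_cst (1 : R) x 1)
        (is_deriveM (is_derive_cst al x 1) df))).
      by rewrite /GRing.scale /= mulr0 addr0 add0r.
    exact: (@is_derive1_comp R (@ln R) (fun y => 1 + al * f y) x _ _ (is_derive1_ln fx) dg).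
  have d1 := dln 0 _ _ dc h1; have d2 := dln 0 _ _ (is_deriveN dc) h2.
  apply: (@is_derive_eq _ _ _ _ _ _ _ _
    (is_deriveM (is_derive_cst (- (L / (4 * al))) x 1) (is_deriveB d1 d2))).
  rewrite /GRing.scale /= mulr0 addr0 /hinge_speed den.
  have -> : (- (fun y : R => cos (y / 2))) x = - cos (x / 2) by [].
  have -> : (Cpar - Cperp) / Cperp = - al ^+ 2 by rewrite al2 -mulNr opprB.
  have h3 : 1 + - al ^+ 2 * cos (x / 2) ^+ 2 != 0.
    have -> : 1 + - al ^+ 2 * cos (x / 2) ^+ 2 =
      (1 + al * cos (x / 2)) * (1 + al * - cos (x / 2)) by ring.
    by rewrite mulf_neq0 ?lt0r_neq0.
  move: (lt0r_neq0 h1) (lt0r_neq0 h2) h3 (lt0r_neq0 al0) C0.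
  move: (cos _) (sin _) => c s e1 e2 e3 e4 e5.
  field; by rewrite ?e1 ?e2 ?e3 ?e4 ?e5.
- pose al : R := Num.sqrt ((Cpar - Cperp) / Cperp).
  have q0 : 0 < (Cpar - Cperp) / Cperp by rewrite divr_gt0 // subr_gt0.
  have al0 : 0 < al by rewrite sqrtr_gt0.
  have al2 : al ^+ 2 = (Cpar - Cperp) / Cperp by rewrite sqr_sqrtr // ltW.
  exists (fun x => - (L / (2 * al)) * atan (al * cos (x / 2))) => x.
  have dc := is_derive_half_cos x.
  have da : is_derive x 1 (fun y => atan (al * cos (y / 2)))
      ((1 + (al * cos (x / 2)) ^+ 2)^-1 * (al * - (1 / 2 * sin (x / 2)))).
    have dg : is_derive x 1 (fun y => al * cos (y / 2)) (al * - (1 / 2 * sin (x / 2))).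
      apply: (@is_derive_eq _ _ _ _ _ _ _ _ (is_deriveM (is_derive_cst al x 1) dc)).
      by rewrite /GRing.scale /= mulr0 addr0.
    exact: (@is_derive1_comp R (@atan R) (fun y => al * cos (y / 2)) x _ _ (is_derive1_atan _) dg).
  apply: (@is_derive_eq _ _ _ _ _ _ _ _
    (is_deriveM (is_derive_cst (- (L / (2 * al))) x 1) da)).
  rewrite /GRing.scale /= mulr0 addr0 /hinge_speed den -al2 exprMn.
  have h3 : 1 + al ^+ 2 * cos (x / 2) ^+ 2 != 0.
    by rewrite lt0r_neq0 // ltr_pwDl // mulr_ge0 ?sqr_ge0.
  move: h3 (lt0r_neq0 al0) C0; move: (cos _) (sin _) => c s e3 e4 e5.
  by field; rewrite exprMn e3 e4 e5.
Qed.

Variable d : R -> R.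
Hypothesis dE : forall x : R, is_derive x 1 d (hinge_speed x).
Local Notation bis := (bis d).
Local Notation reach := (reach Cpar Cperp Ctau L).
Local Notation axis_frame := (axis_frame L d).
Local Notation axis_frame_inv := (axis_frame_inv L d).
Local Notation axis_height := (axis_height L d).
Local Notation spin_rate := (spin_rate Cperp Ctau L).

(* This is where the anisotropy of the drag is needed. *)
Lemma axis_height_neq : axis_height pi != axis_height (pi / 2).
Proof.
have p0 := pi_gt0 R.
have dm (x : R) : is_derive x 1 axis_height
    (hinge_speed x + L / 2 * - (1 / 2 * sin (x / 2))).
  apply: (@is_derive_eq _ _ _ _ _ _ _ _ (is_deriveD (dE x)
    (is_deriveM (is_derive_cst (L / 2) x 1) (is_derive_half_cos x)))).
  by rewrite /GRing.scale /= mulr0 addr0.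
have pp : pi / 2 < pi :> R by lra.
(* The derivative is taken at a point strictly between [pi / 2] and [pi], where the sine and cosine
   of [x / 2] are positive and only [Cperp - Cpar] could vanish. *)
have [|x] := MVT pp (fun x _ => dm x) _.
  by apply: derivable_within_continuous => x _; have [] := dm x.
rewrite in_itv /= => /andP[x1 x2] E.
have s0 : 0 < sin (x / 2) by apply: sin_gt0_pi; apply/andP; split; lra.
have c0 : 0 < cos (x / 2) by apply: cos_gt0_pihalf; apply/andP; split; lra.
have A0 := drag_bisector_gt0 Cpar0 Cperp0 x.
rewrite -subr_eq0 E mulf_neq0 //; last by lra.
have -> : hinge_speed x + L / 2 * - (1 / 2 * sin (x / 2)) =
  L * sin (x / 2) * cos (x / 2) ^+ 2 * (Cperp - Cpar) /
  (4 * (Cpar * cos (x / 2) ^+ 2 + Cperp * sin (x / 2) ^+ 2)).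
  have ec := cos2sin2 (x / 2); rewrite /hinge_speed.
  move: (lt0r_neq0 A0) ec; move: (cos _) (sin _) => c s A1 ec; by field: ec.
rewrite mulf_neq0 ?invr_neq0 ?mulf_neq0 ?expf_neq0 ?(lt0r_neq0 s0) ?(lt0r_neq0 c0)
  ?(lt0r_neq0 L0) ?(lt0r_neq0 A0) //.
by rewrite subr_eq0 eq_sym.
Qed.

(* [transports h t]: in the frame of the bisector, [h] can be applied on the
   right while [th] grows by [t], whatever the initial and final [ph]. *)
Definition transports (h : 'M[R]_4) (t : R) : Prop := in_SE3 h /\
  forall k th p q, in_SE3 k ->
    reach (k *m bis p *m rotz (- th)) th p (k *m h *m bis q *m rotz (- (th + t))) (th + t) q.

Lemma transportsM h h' t t' : transports h t -> transports h' t' ->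
  transports (h *m h') (t + t').
Proof.
move=> [Sh Rh] [Sh' Rh']; split; first exact: in_SE3M.
move=> k th p q Sk; apply: (reach_trans (Rh k th p q Sk)).
by rewrite mulmxA addrA; apply: Rh'; exact: in_SE3M.
Qed.

Lemma in_SE3_axis (p s : R) : in_SE3 (axis_frame p *m rotz s *m axis_frame_inv p).
Proof.
have SF : in_SE3 (axis_frame p) by apply: in_SE3_ymat; exact: axis_unit.
have [G SG [FG _]] := in_SE3_inv SF.
have -> : axis_frame_inv p = G.
  by rewrite -[LHS]mulmx1 -FG mulmxA ymat_invK ?axis_unit // mul1mx.
by apply: in_SE3M => //; apply: in_SE3M => //; exact: in_SE3_rotz.
Qed.

(** Bend to the angle [p], spin there, then bend to the prescribed angle. *)
Lemma transports_spin (p t : R) :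
  transports (axis_frame p *m rotz (spin_rate p * t) *m axis_frame_inv p) t.
Proof.
split; first exact: in_SE3_axis.
move=> k th p0 q Sk.
have b1 := reach_bend Cpar0 Cperp0 Ctau0 L0 dE th p0 p Sk.
have sp := reach_spin Cpar0 Cperp0 Ctau0 L0 d th p t Sk.
apply: (reach_trans b1); apply: (reach_trans sp).
by apply: reach_bend => //; apply: in_SE3M => //; exact: in_SE3_axis.
Qed.

(** Spin at [ph = 0]: the axis is the bisector, the rate is 1, and the height is immaterial because
    translations along z commute with [rotz]. *)
Lemma transports_rotz (t : R) : transports (rotz t) t.
Proof.
have := transports_spin 0 t.
have -> : spin_rate 0 = 1.
  rewrite /spin_rate /axis_norm /tilt_rate mul0r sin0 cos0 !expr0n !expr1n /=.
  by rewrite !mul0r !mulr0 !add0r addr0 expr0n /= mulr0 add0r !mulr1 sqrtr1 mulr1 divff // lt0r_neq0 // mulr_gt0.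
rewrite mul1r /axis_frame /axis_frame_inv /axis_cos /axis_sin /axis_norm mul0r sin0 cos0.
rewrite !expr0n !expr1n /= !mulr0 add0r sqrtr1 !divr1.
set m := axis_height 0.
have -> : ymat 1 0 m *m rotz t *m ymat_inv 1 0 m = rotz t.
  have u : 1 ^+ 2 + 0 ^+ 2 = 1 :> R by rewrite expr0n expr1n addr0.
  have -> : ymat 1 0 m *m rotz t = rotz t *m ymat 1 0 m.
    by apply/matrixP => -[[|[|[|[|//]]]] ?] -[[|[|[|[|//]]]] ?];
      rewrite !mxE ?big_ord_recr ?big_ord0 /= ?mxE /=; ring.
  by rewrite -mulmxA ymatK // mulmx1.
by [].
Qed.

Lemma axis_pi : [/\ axis_cos pi = 0 :> R, axis_sin pi = 1 :> R & spin_rate pi = 1].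
Proof.
have n4 : axis_norm pi = 4 :> R.
  rewrite /axis_norm sin_pihalf cos_pihalf expr0n expr1n /= addr0 mulr1.
  have -> : 16 = 4 ^+ 2 :> R by ring.
  by rewrite sqrtr_sqr ger0_norm.
have C0 := lt0r_neq0 Ctau0.
split.
- by rewrite /axis_cos cos_pihalf expr0n mul0r.
- by rewrite /axis_sin sin_pihalf n4 expr1n mulr1 divff.
- rewrite /spin_rate n4 /tilt_rate sin_pihalf cos_pihalf mulr0 !expr0n !expr1n /=.
  by field.
Qed.

(* With [X] the half-turn at [ph = pi], [rotz a * X * rotz (- a) * X^-1] equals
   [rotz (2 a)] and leaves [th] unchanged. *)
Lemma transports1 (t : R) : transports 1%:M t.
Proof.
pose m := axis_height pi.
have X s : transports (ymat 0 1 m *m rotz s *m ymat_inv 0 1 m) s.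
  have [c0 s1 r1] := axis_pi; have := transports_spin pi s.
  by rewrite r1 mul1r /axis_frame /axis_frame_inv c0 s1.
(* Chosen so that the commutator [rotz (2 a)] undoes the rotation that accompanies an increase of
   [th] by [t]. *)
pose a := - t / 2.
have conj : transports (rotz (- t)) 0.
  have := transportsM (transportsM (transports_rotz a) (X pi))
    (transportsM (transports_rotz (- a)) (X (- pi))).
  have -> : a + pi + (- a + - pi) = 0 by ring.
  have half : ymat 0 1 m *m rotz pi *m ymat_inv 0 1 m = mxseq 4 4
      [:: [:: 1; 0; 0; 0]; [:: 0; -1; 0; 0]; [:: 0; 0; -1; 2 * m]; [:: 0; 0; 0; 1]].
    have u : 0 ^+ 2 + 1 ^+ 2 = 1 :> R by rewrite expr0n expr1n add0r.
    set X' := (X' in _ = X').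
    have -> : ymat 0 1 m *m rotz pi = X' *m ymat 0 1 m.
      by apply/matrixP => -[[|[|[|[|//]]]] ?] -[[|[|[|[|//]]]] ?];
        rewrite !mxE ?big_ord_recr ?big_ord0 /= ?mxE /= ?cospi ?sinpi; ring.
    by rewrite -mulmxA ymatK // mulmx1.
  (* The half-turns by [pi] and [- pi] are the same motion, yet they change [th] by opposite
     amounts. *)
  have -> : rotz (- pi) = rotz pi :> 'M[R]_4.
    by rewrite /rotz cosN sinN cospi sinpi oppr0.
  rewrite half; set X' := mxseq 4 4 _.
  have XX : X' *m X' = 1%:M.
    by apply/matrixP => -[[|[|[|[|//]]]] ?] -[[|[|[|[|//]]]] ?];
      rewrite !mxE ?big_ord_recr ?big_ord0 /= ?mxE /=; ring.
  have XR : X' *m rotz (- a) = rotz a *m X'.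
    by apply/matrixP => -[[|[|[|[|//]]]] ?] -[[|[|[|[|//]]]] ?];
      rewrite !mxE ?big_ord_recr ?big_ord0 /= ?mxE /= ?cosN ?sinN; ring.
  rewrite !mulmxA -(mulmxA _ X' (rotz _)) XR !mulmxA -(mulmxA _ X' X') XX mulmx1 rotzD.
  by have -> : a + a = - t by rewrite /a; field.
by have := transportsM (transports_rotz t) conj; rewrite rotzKN addr0.
Qed.

Lemma transports_any (h : 'M[R]_4) : in_SE3 h -> forall t, transports h t.
Proof.
move: h.
(* A motion available for one increment of [th] is available for all of them, so membership in the
   generated set no longer has to track [th]. *)
have free g s : transports g s -> forall t, transports g t.
  move=> gs u; have := transportsM gs (transports1 (u - s)).
  by rewrite mulmx1 subrKC.
have spin p s : forall t, transports (axis_frame p *m rotz s *m axis_frame_inv p) t.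
  apply: (free _ (s / spin_rate p)); have := transports_spin p (s / spin_rate p).
  by rewrite mulrC divfK // lt0r_neq0 // spin_rate_gt0.
have [c0 s1 _] := axis_pi.
apply: (@SE3_generated R (fun h => forall t, transports h t)
  (axis_cos (pi / 2)) (axis_sin (pi / 2)) (axis_height pi) (axis_height (pi / 2))).
- exact: axis_unit.
- have p0 := pi_gt0 R.
  have s0 : 0 < sin (pi / 2 / 2) :> R by apply: sin_gt0_pi; apply/andP; split; lra.
  by rewrite lt0r_neq0 // divr_gt0 ?axis_norm_gt0 // mulr_gt0 // exprn_gt0.
- exact: axis_height_neq.
- by move=> g g' Hg Hg' u; have := transportsM (Hg u) (Hg' 0); rewrite addr0.
- by move=> s; apply: free; exact: transports_rotz.
- by move=> s; have := spin pi s; rewrite /axis_frame /axis_frame_inv c0 s1.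
- by move=> s; exact: spin.
Qed.

Lemma reach_any (g0 g1 : 'M[R]_4) (th p : R) : in_SE3 g0 -> in_SE3 g1 ->
  reach g0 th p g1 th p.
Proof.
move=> S0 S1.
have SB : in_SE3 (bis p) by apply: in_SE3_ymat; exact: bis_unit.
have [Bi SBi [BBi BiB]] := in_SE3_inv SB.
(* The frame of the bisector at the start, so that [g0 = k *m bis p *m rotz (- th)]. *)
pose k := g0 *m rotz th *m Bi.
have Sk : in_SE3 k by apply: in_SE3M => //; apply: in_SE3M => //; exact: in_SE3_rotz.
have [ki Ski [kki kik]] := in_SE3_inv Sk.
(* The motion to apply takes [k] to the frame of the bisector that corresponds to [g1] in the same
   shape. *)
have [|_ /(_ k th p p Sk)] := @transports_any (ki *m g1 *m rotz th *m Bi) _ 0.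
  by apply: in_SE3M => //; apply: in_SE3M => //; [exact: in_SE3M | exact: in_SE3_rotz].
rewrite addr0 !mulmxA kki mul1mx -!(mulmxA _ Bi) BiB !mulmx1.
by rewrite -!(mulmxA _ (rotz th)) rotzKN !mulmx1.
Qed.

End Controllability.

(** * The null set of isotropic parameters *)

Section Final.
Variable R : realType.
Local Open Scope ereal_scope.
Local Notation mu := (@lebesgue_measure R).

Lemma measurable_diagonal : measurable [set p : R * R | p.1 = p.2].
Proof.
rewrite (_ : [set _ | _] = (fun p : R * R => (p.1 - p.2)%R) @^-1` [set 0%R]).
  rewrite -[X in measurable X]setTI.
  have mf : measurable_fun [set: R * R] (fun p : R * R => (p.1 - p.2)%R).
    by apply: measurable_funB; [exact: measurable_fst | exact: measurable_snd].
  exact: mf.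
apply/seteqP; split => -[x y] /=; first by move=> ->; rewrite subrr.
by move/eqP; rewrite subr_eq0 => /eqP.
Qed.

(** Every section of the diagonal is a single point. *)
Lemma diagonal_measure0 : (mu \x mu) [set p : R * R | p.1 = p.2] = 0.
Proof.
rewrite /product_measure1; apply: integral0_eq => x _ /=.
rewrite (_ : xsection _ x = [set x]); first exact: lebesgue_measure_set1.
by apply/seteqP; split => y; rewrite /xsection /= inE /= => ->.
Qed.

Lemma negligible_isotropic :
  (lebesgue_measure4 R).-negligible [set p : R * R * R * R | p.1.1.1 = p.1.1.2].
Proof.
pose D := [set p : R * R | p.1 = p.2].
have mD : measurable D by exact: measurable_diagonal.
have mDT : measurable (D `*` [set: R]) by exact: measurableX.
exists ((D `*` [set: R]) `*` [set: R]); split.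
- exact: measurableX.
- have D3 : (mu \x mu \x mu) (D `*` [set: R]) = 0.
    apply: etrans (product_measure1E (mu \x mu) mu mD measurableT) _.
    by rewrite [X in X * _]diagonal_measure0 mul0e.
  apply: etrans (product_measure1E (mu \x mu \x mu) mu mDT measurableT) _.
  by rewrite [X in X * _]D3 mul0e.
- by move=> [[[a b] c] e] /= ->.
Qed.

End Final.

Lemma anisotropic_fiber_controllable (R : realType) (Cpar Cperp Ctau L : R) :
  0 < Cpar -> 0 < Cperp -> 0 < Ctau -> 0 < L -> Cpar != Cperp ->
  fiber_controllable Cpar Cperp Ctau L.
Proof.
move=> Cpar0 Cperp0 Ctau0 L0 aniso g0 [th ph] g1 S0 S1.
have [d dE] := hinge_antiderivative L Cpar0 Cperp0 aniso.
(* The control found is a loop in shape space: the final shape is the initial one. *)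
have := reach_any Cpar0 Cperp0 Ctau0 L0 aniso dE th (repr ph) S0 S1.
by move/reach_control; rewrite reprK.
Qed.

Theorem theorem3p7 (R : realType) :
  {ae lebesgue_measure4 R, forall p : R * R * R * R,
     let: (Cpar, Cperp, Ctau, L) := p in
     0 < Cpar -> 0 < Cperp -> 0 < Ctau -> 0 < L ->
     fiber_controllable Cpar Cperp Ctau L}.
Proof.
(* By contraposition, parameters for which the claim fails satisfy [Cpar = Cperp]. *)
apply: negligibleS (@negligible_isotropic R) => -[[[Cpar Cperp] Ctau] L] /= H.
apply: contrapT => /eqP aniso; apply: H => *.
exact: anisotropic_fiber_controllable.
Qed.
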